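(* Let $n\ge 3$, let $K\subset\mathbb{R}^n$ be a convex body, and let $S\subset\operatorname{int}K$ be an $(n-1)$-sphere with center $p$. Suppose that: (1) for every supporting hyperplane $\Pi$ of $S$ the section $\Pi\cap K$ is centrally symmetric; and (2) for every pair of parallel supporting hyperplanes $\Pi_1,\Pi_2$ of $S$ the sections $\Pi_1\cap K$ and $\Pi_2\cap K$ are translated. Then $K$ is centrally symmetric.
   Context: A convex body in $\mathbb{R}^n$ is a compact convex set with non-empty interior. An $(n-1)$-sphere with center $p$ is a set $\{x\in\mathbb{R}^n:\|x-p\|=r\}$ with $r>0$. A set $W$ is centrally symmetric if there is a point $c$ with $2c-W=W$. Two sets $W_1,W_2$ are translated if $W_2=w+W_1$ for some vector $w\in\mathbb{R}^n$ (possibly zero). *)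

(* Defs.v *)
(* R^n is ['rV[R]_n] over an arbitrary [R : realType]. *)
From HB Require Import structures.
From mathcomp Require Import all_boot all_order all_algebra.
From mathcomp Require Import all_classical all_reals all_analysis.

Set Implicit Arguments.
Unset Strict Implicit.
Unset Printing Implicit Defensive.

Import Order.TTheory GRing.Theory Num.Theory.
Import numFieldNormedType.Exports.

Local Open Scope classical_set_scope.
Local Open Scope ring_scope.

Section Definitions.
Variables (R : realType) (n : nat).
Implicit Types (x y u c w p : 'rV[R]_n) (W K S H : set 'rV[R]_n).

Definition dotv x y : R := \sum_(i < n) x ord0 i * y ord0 i.

(* The library norm [`|x|] on row vectors is the sup norm, which induces the
   same topology but not the same spheres. *)
Definition enorm x : R := Num.sqrt (dotv x x).

Definition convex_body K : Prop :=
  [/\ compact K, convex_set K & K° !=set0].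

Definition esphere p (r : R) : set 'rV[R]_n := [set x | enorm (x - p) = r].

Definition is_sphere S p : Prop := exists2 r : R, 0 < r & S = esphere p r.

Definition hyperplane u (a : R) : set 'rV[R]_n := [set x | dotv u x = a].

(* Replacing [(u, a)] by [(- u, - a)] gives the same hyperplane, so a single
   inequality covers both closed half-spaces bounded by [H]. *)
Definition supporting_hyperplane W H : Prop :=
  exists u (a : R),
    [/\ u != 0, H = hyperplane u a, H `&` W !=set0
      & W `<=` [set x | dotv u x <= a]].

(* A hyperplane is parallel to itself under this definition. *)
Definition parallel_hyperplanes H1 H2 : Prop :=
  exists u (a b : R),
    [/\ u != 0, H1 = hyperplane u a & H2 = hyperplane u b].

Definition centrally_symmetric W : Prop :=
  exists c, [set c *+ 2 - x | x in W] = W.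

Definition translated W1 W2 : Prop :=
  exists w, W2 = [set w + x | x in W1].

End Definitions.

(* Main.v *)
(* Orthogonal projection to a three-dimensional subspace commutes with sections by
   hyperplanes containing its kernel, so it suffices to treat n = 3, with the unit
   sphere centred at 0. Put K' = -K. For a unit vector v the sections of K and K'
   by the plane tangent to the ball at v differ by a translation t(v) orthogonal
   to v; t is continuous and even. An even tangent field on the two-sphere has a
   zero: trivialise the tangent planes over the upper hemisphere; the field there,
   if nowhere zero, has a continuous square root on the equator up to positive
   factors, and evenness makes this incompatible with connectedness.

   The zero set Z of t is open. Let t(u) = 0 and v_i -> u with t(v_i) <> 0, and
   let Q be the common section at u. If t(v) points below the plane of u, then
   near that plane the section of K at v contains two parallel chords, one in Q and
   its translate by -t(v) above it. Moving from v_i through tops of sections of K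
   outside K', one reaches tangent planes at w_i with t(w_i) <> 0 that converge to
   a tangent plane meeting the plane of u in a supporting line of Q at an exposed
   point p. The sections by these planes have their centres below the plane of u,
   so the chord they cut on Q is at least as long as a chord of the ball of
   half-length q > 0, although these chords shrink to p. Hence Z is the whole
   sphere and K = -K. *)
Require Import Defs.
From mathcomp Require Import all_boot all_order all_algebra.
From mathcomp Require Import all_classical all_reals all_analysis.
From mathcomp Require Import ring lra.

Set Implicit Arguments.
Unset Strict Implicit.
Unset Printing Implicit Defensive.

Import Order.TTheory GRing.Theory Num.Theory.
Import numFieldNormedType.Exports.

Local Open Scope classical_set_scope.
Local Open Scope ring_scope.

(** * Euclidean geometry of row vectors *)

Section DotProduct.
Variables (R : realType) (n : nat).
Implicit Types (x y z : 'rV[R]_n) (k : R).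

Lemma dotvC x y : dotv x y = dotv y x.
Proof. by apply: eq_bigr => i _; rewrite mulrC. Qed.

Lemma dotvDr x y z : dotv x (y + z) = dotv x y + dotv x z.
Proof. by rewrite -big_split; apply: eq_bigr => i _; rewrite mxE mulrDr. Qed.

Lemma dotvZr k x y : dotv x (k *: y) = k * dotv x y.
Proof. by rewrite mulr_sumr; apply: eq_bigr => i _; rewrite mxE mulrCA. Qed.

Lemma dotvDl x y z : dotv (y + z) x = dotv y x + dotv z x.
Proof. by rewrite !(dotvC _ x) dotvDr. Qed.

Lemma dotvZl k x y : dotv (k *: y) x = k * dotv y x.
Proof. by rewrite !(dotvC _ x) dotvZr. Qed.

Lemma dotvNr x y : dotv x (- y) = - dotv x y.
Proof. by rewrite -scaleN1r dotvZr mulN1r. Qed.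

Lemma dotvNl x y : dotv (- y) x = - dotv y x.
Proof. by rewrite !(dotvC _ x) dotvNr. Qed.

Lemma dotv0 x : dotv x 0 = 0.
Proof. by rewrite -(scale0r 0) dotvZr mul0r. Qed.

Definition dotE := (dotvDl, dotvDr, dotvNl, dotvNr, dotvZl, dotvZr).

Lemma dotvv_ge0 x : 0 <= dotv x x.
Proof. by apply: sumr_ge0 => i _; rewrite -expr2 sqr_ge0. Qed.

Lemma dotvv_eq0 x : (dotv x x == 0) = (x == 0).
Proof.
apply/eqP/eqP => [|->]; last by rewrite dotv0.
move=> /eqP; rewrite psumr_eq0 => [/allP h|i _]; last by rewrite -expr2 sqr_ge0.
apply/rowP => j; have := h j (mem_index_enum _).
by rewrite !mxE mulf_eq0 orbb => /eqP.
Qed.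

Lemma dotvv_gt0 x : x != 0 -> 0 < dotv x x.
Proof. by move=> x0; rewrite lt_neqAle eq_sym dotvv_eq0 x0 dotvv_ge0. Qed.

Lemma dotv_cauchy x y : (dotv x y) ^+ 2 <= dotv x x * dotv y y.
Proof.
have [->|y0] := eqVneq y 0; first by rewrite !dotv0 mulr0 expr0n.
have /ltW yy := dotvv_gt0 y0.
have := dotvv_ge0 (dotv y y *: x - dotv x y *: y).
rewrite !dotE (dotvC y x); set a := dotv x x; set b := dotv x y.
set c := dotv y y => h; have c0 : 0 < c by exact: dotvv_gt0.
have {h} : 0 <= c * (a * c - b ^+ 2) by nra.
by rewrite pmulr_rge0 // subr_ge0.
Qed.

Lemma dotv_le1 x y : dotv x x = 1 -> dotv y y = 1 -> `|dotv x y| <= 1.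
Proof.
move=> xx yy; have := dotv_cauchy x y; rewrite xx yy mulr1 ler_norml => h.
by apply/andP; split; nra.
Qed.

Definition normalize x : 'rV[R]_n := (Num.sqrt (dotv x x))^-1 *: x.

Lemma normalize_dotvv x : x != 0 -> dotv (normalize x) (normalize x) = 1.
Proof.
move=> /dotvv_gt0 xx; rewrite /normalize !dotE mulrA -invfM -expr2 sqr_sqrtr ?ltW //.
by rewrite mulVf // gt_eqF.
Qed.

Lemma coord_sqr_le_dotvv x i : x ord0 i ^+ 2 <= dotv x x.
Proof.
rewrite /dotv (bigD1 i) //= -expr2 lerDl sumr_ge0 // => j _.
by rewrite -expr2 sqr_ge0.
Qed.

End DotProduct.

(** * Limits of row vectors along filters and ultrafilters *)

Section DotConvergence.
Variables (R : realType) (n : nat) (T : Type) (F : set_system T).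
Context {FF : ProperFilter F}.
Implicit Types (f g : T -> 'rV[R]_n) (x y : 'rV[R]_n).

Lemma cvg_coord f x i : f @ F --> x -> (fun t => f t ord0 i) @ F --> x ord0 i.
Proof.
by move=> fx; apply: (@cvg_comp _ _ _ f (fun z : 'rV[R]_n => z ord0 i) _ _ _ fx);
  exact: coord_continuous.
Qed.

Lemma cvg_big_sum m (h : 'I_m -> T -> R) (l : 'I_m -> R) :
  (forall i, h i @ F --> l i) ->
  (fun t => \sum_(i < m) h i t) @ F --> \sum_(i < m) l i.
Proof.
elim: m h l => [|m IH] h l hl.
  under eq_fun do rewrite big_ord0; rewrite big_ord0; exact: cvg_cst.
under eq_fun do rewrite big_ord_recl; rewrite big_ord_recl.
by apply: cvgD => //; apply: IH => i.
Qed.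

Lemma cvg_dotv f g x y : f @ F --> x -> g @ F --> y ->
  (fun t => dotv (f t) (g t)) @ F --> dotv x y.
Proof.
by move=> fx gy; apply: cvg_big_sum => i; apply: cvgM; exact: cvg_coord.
Qed.

Lemma cvg_rV f x : (forall i, (fun t => f t ord0 i) @ F --> x ord0 i) ->
  f @ F --> x.
Proof.
move=> h; apply/cvgrPdist_lt => e e0.
have : \forall t \near F, forall i, `|x ord0 i - f t ord0 i| < e.
  apply: filter_forall => i; have /cvgrPdist_lt := h i; exact.
apply: filter_app; near=> t => ht.
rewrite [`|_|]mx_normE; apply/(lt_le_trans (y := e)) => //.
apply: (@big_ind _ (fun z : {nonneg R} => z%:num < e)) => //=.
  by move=> a b ae be; rewrite num_max gt_max ae be.
by move=> [i j] _ /=; rewrite !mxE (ord1 i); exact: ht.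
Unshelve. all: by end_near. Qed.

End DotConvergence.

(** Ultrafilters take the place of passing to subsequences: a cluster point of an ultrafilter is a
    limit of it. *)
Lemma ultra_compact_cvg (T : Type) (V : topologicalType) (U : set_system T)
    (A : set V) (f : T -> V) : UltraFilter U -> compact A ->
  (\forall t \near U, A (f t)) -> exists2 l, A l & f @ U --> l.
Proof.
move=> UU cA fA; have [l [Al cl]] := cA (f @ U) _ fA.
exists l => // B Bl.
have [//|UB] := in_ultra_setVsetC (f @^-1` B) UU.
by have [y [/= ? ?]] := cl (~` B) B UB Bl.
Qed.

(** * Compact and convex sets *)

Section CompactSets.
Variables (R : realType) (n : nat).
Implicit Types (x y d v a t : 'rV[R]_n) (K : set 'rV[R]_n).

Lemma dotv_continuous d : continuous (dotv d).
Proof.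
move=> x.
exact: (@cvg_dotv R n _ (nbhs x) (nbhs_pfilter x) (fun=> d) id d x (cvg_cst _)).
Qed.

Lemma sqdist_continuous d : continuous (fun x => dotv (x - d) (x - d)).
Proof.
move=> x; have FF : ProperFilter (nbhs (x : 'rV[R]_n)) := nbhs_pfilter _.
have cx : (fun y => y - d) @ nbhs (x : 'rV[R]_n) --> (x - d : 'rV[R]_n).
  by apply: cvgB; [exact: cvg_id|exact: cvg_cst].
exact: (@cvg_dotv R n _ (nbhs x) (nbhs_pfilter x) _ _ _ _ cx cx).
Qed.

Lemma compact_closed_rV K : compact K -> closed K.
Proof. by apply: compact_closed; exact: norm_hausdorff. Qed.

Lemma closed_hyperplane v (k : R) : closed (hyperplane v k).
Proof.
exact: (continuous_closedP _).1 (@dotv_continuous v) _ (closed_eq (y := k)).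
Qed.

Lemma compact_hyperplane K v (k : R) : compact K -> compact (K `&` hyperplane v k).
Proof. by move=> cK; apply: compact_closedI => //; exact: closed_hyperplane. Qed.

Lemma compact_argmax K d : K !=set0 -> compact K ->
  exists2 x, K x & forall y, K y -> dotv d y <= dotv d x.
Proof.
move=> K0 cK; have [|x] := @EVT_max_rV R n (dotv d) K K0 cK.
  by apply: continuous_subspaceT; exact: dotv_continuous.
by rewrite inE => Kx h; exists x => // y Ky; apply: h; rewrite inE.
Qed.

Lemma compact_dotv_bounded K d : compact K ->
  exists2 C : R, 0 < C & forall x, K x -> `|dotv d x| <= C.
Proof.
move=> cK; have [->|K0] := eqVneq K set0; first by exists 1.
have {}K0 : K !=set0 by apply/set0P.
have [x _ hx] := compact_argmax d K0 cK.
have [y _ hy] := compact_argmax (- d) K0 cK.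
exists (`|dotv d x| + `|dotv d y| + 1) => [|z Kz].
  by rewrite ltr_wpDl // addr_ge0.
have := hx _ Kz; have := hy _ Kz; rewrite !dotE ler_norml => h1 h2.
have := ler_norm (dotv d x); have := ler_norm (- dotv d y); rewrite normrN.
have := normr_ge0 (dotv d x); have := normr_ge0 (dotv d y).
by move=> ? ? ? ?; apply/andP; split; lra.
Qed.

(** On the compact set [K] the product with [t] is bounded, while each further step along [- t]
    lowers it by [dotv t t]. *)
Lemma compact_ray_eq0 K a t : compact K ->
  (forall k : nat, K (a - k%:R *: t)) -> t = 0.
Proof.
move=> cK h; apply/eqP; rewrite -dotvv_eq0; apply/negPn/negP => tt0.
have {tt0} tt : 0 < dotv t t by rewrite lt_neqAle eq_sym tt0 dotvv_ge0.
have [C C0 hC] := compact_dotv_bounded t cK.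
pose k := Num.bound ((C + `|dotv t a|) / dotv t t).
have hk : (C + `|dotv t a|) / dotv t t < k%:R.
  by rewrite archi_boundP // divr_ge0 ?dotvv_ge0 // addr_ge0 // ltW.
move: hk; rewrite ltr_pdivrMr // => hk.
have := hC _ (h k); rewrite !dotE ler_norml => /andP[+ _].
by have := ler_norm (dotv t a); lra.
Qed.

End CompactSets.

Section ConvexSets.
Variables (R : realType) (n : nat).
Implicit Types (x y u v a : 'rV[R]_n) (K : set 'rV[R]_n).

Definition segment_closed K := forall x y (l : R), K x -> K y -> 0 <= l <= 1 ->
  K ((1 - l) *: x + l *: y).

(** Starting at [a], the iterates of the contraction towards [y] stay in [A] and converge to its
    fixed point [y]. *)
Lemma closed_contraction (A : set 'rV[R]_n) y a (r : R) : closed A -> 0 <= r < 1 ->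
  A a -> (forall b, A b -> A ((1 - r) *: y + r *: b)) -> A y.
Proof.
move=> cA /andP[r0 r1] Aa h.
have hk k : A (y + r ^+ k *: (a - y)).
  elim: k => [|k IH]; first by rewrite expr0 scale1r addrC subrK.
  have := h _ IH; congr A; apply/rowP => j; rewrite !mxE exprS; ring.
apply: (@closed_cvg _ _ \oo _ (fun k => y + r ^+ k *: (a - y)) A cA).
  by apply: nearW => k; exact: hk.
rewrite -[X in _ --> X]addr0 -(scale0r (a - y)); apply: cvgD; first exact: cvg_cst.
apply: cvgZr_tmp; apply: cvg_expr; by rewrite ger0_norm.
Qed.

(** Lower semicontinuity of the tangent sections: every point of the section at [u] is a limit of
    points of the nearby sections. This holds because [K] contains a ball of radius larger than
    1. *)
Lemma section_lsc (T : Type) (F : set_system T) {FF : ProperFilter F} K (q : R)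
    (u_ : T -> 'rV[R]_n) u y : segment_closed K -> 0 < q ->
    (forall x, dotv x x <= (1 + q) ^+ 2 -> K x) ->
    (\forall t \near F, dotv (u_ t) (u_ t) = 1) -> u_ @ F --> u ->
    K y -> dotv u y = 1 ->
  exists2 y_ : T -> 'rV[R]_n, y_ @ F --> y
    & \forall t \near F, K (y_ t) /\ dotv (u_ t) (y_ t) = 1.
Proof.
move=> cK q0 ball u1 cu Ky uy.
(* The defect [d] is corrected by mixing [y], with weight [m], with the multiple [1 + s q (1 - m)]
   of [u_ t], where [s] is the sign of [d]. That multiple has length at most [1 + q], so it lies in
   [K]. *)
pose d t : R := 1 - dotv (u_ t) y; pose m t : R := `|d t| / q.
have cd : d @ F --> (0 : R).
  rewrite -(subrr 1) -[X in _ - X]uy; apply: cvgB; first exact: cvg_cst.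
  by apply: cvg_dotv => //; exact: cvg_cst.
have cm : m @ F --> (0 : R).
  rewrite -(mul0r q^-1) -(normr0 R); apply: cvgM; last exact: cvg_cst.
  exact: cvg_norm.
exists (fun t => (1 - m t) *: y + (m t + d t * (1 - m t)) *: u_ t).
  have y0 : (1 - 0) *: y + (0 + 0 * (1 - 0)) *: u = y.
    by rewrite subr0 scale1r mul0r addr0 scale0r addr0.
  have c1m : (fun t => 1 - m t) @ F --> (1 - 0 : R) by apply: cvgB => //; exact: cvg_cst.
  rewrite -[X in _ --> X]y0.
  apply: cvgD; first by apply: cvgZ => //; exact: cvg_cst.
  by apply: cvgZ => //; apply: cvgD => //; exact: cvgM.
have m1 : \forall t \near F, m t <= 1 by exact: (cvgr_le 0 cm _ ltr01).
near=> t.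
have ut : dotv (u_ t) (u_ t) = 1 by near: t.
have m1t : m t <= 1 by near: t.
split; last by rewrite !dotE ut /d; ring.
have m0 : 0 <= m t by rewrite divr_ge0 // ltW.
have ds : d t = m t * q * Num.sg (d t).
  by rewrite divfK ?gt_eqF // mulrC -numEsg.
set s := Num.sg (d t) in ds.
have s1 : `|s| <= 1 by rewrite normr_sg; case: (_ != 0); rewrite ?ler01.
have := cK y ((1 + s * q * (1 - m t)) *: u_ t) (m t) Ky.
rewrite scalerA (_ : m t + d t * (1 - m t) = m t * (1 + s * q * (1 - m t))).
  apply; last by rewrite m0 m1t.
  apply: ball; rewrite !dotE ut mulr1 -expr2.
  have : `|s * q * (1 - m t)| <= q.
    rewrite !normrM (ger0_norm (ltW q0)) (ger0_norm (_ : 0 <= 1 - m t)) ?subr_ge0 //.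
    rewrite mulrAC ger_pMl // mulr_ile1 ?normr_ge0 ?subr_ge0 // gerBl //.
  rewrite ler_norml; set w := s * q * _ => /andP[w1 w2].
  by rewrite -subr_ge0 (_ : _ - _ = (q - w) * (2 + q + w)); [apply: mulr_ge0; lra|ring].
by rewrite {1}ds; ring.
Unshelve. all: by end_near. Qed.

End ConvexSets.

(** * Pairs of bodies with translated tangent sections *)

Section TangentPair.
Variables (R : realType) (n : nat).
Implicit Types (x y u v a : 'rV[R]_n) (K : set 'rV[R]_n).

(* For a unit vector [v], [t v] translates the section of [K] by the hyperplane
   tangent to the unit ball at [v] onto that of [K'], and [c v] is the centre of
   the section of [K]. *)
Record tangent_pair K K' (q : R) (t c : 'rV[R]_n -> 'rV[R]_n) : Prop := {
  tp_segment : segment_closed K;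
  tp_segment' : segment_closed K';
  tp_compact : compact K;
  tp_compact' : compact K';
  tp_q : 0 < q;
  tp_ball : forall x, dotv x x <= (1 + q) ^+ 2 -> K x;
  tp_ball' : forall x, dotv x x <= (1 + q) ^+ 2 -> K' x;
  tp_perp : forall v, dotv v v = 1 -> dotv v (t v) = 0;
  tp_shift : forall v x, dotv v v = 1 -> dotv v x = 1 -> K' x <-> K (x - t v);
  tp_center : forall v, dotv v v = 1 -> dotv v (c v) = 1;
  tp_sym : forall v x, dotv v v = 1 -> dotv v x = 1 -> K x -> K (c v *+ 2 - x) }.

Lemma tangent_pair_sym K K' q t c : tangent_pair K K' q t c ->
  tangent_pair K' K q (fun v => - t v) (fun v => c v + t v).
Proof.
case=> sK sK' cK cK' q0 b b' tp ts cc cs; split=> //.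
- by move=> v vv; rewrite dotE tp // oppr0.
- move=> v x vv vx; rewrite opprK.
  have vxt : dotv v (x + t v) = 1 by rewrite !dotE tp // addr0.
  by have := ts _ _ vv vxt; rewrite addrK => h; split=> /h.
- by move=> v vv; rewrite dotE cc // tp // addr0.
- move=> v x vv vx K'x.
  have vcx : dotv v ((c v + t v) *+ 2 - x) = 1.
    by rewrite mulr2n !dotE cc // tp // vx; ring.
  apply/(ts _ _ vv vcx).
  have -> : (c v + t v) *+ 2 - x - t v = c v *+ 2 - (x - t v).
    by apply/rowP => j; rewrite !mulr2n !mxE; ring.
  apply: cs => //; first by rewrite !dotE tp // vx; ring.
  exact/ts.
Qed.

Section AgreeingSection.
Variables (K K' : set 'rV[R]_n) (q : R) (t c : 'rV[R]_n -> 'rV[R]_n).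
Hypothesis tp : tangent_pair K K' q t c.
Variable u : 'rV[R]_n.
Hypothesis agree : forall x, dotv u x = 1 -> K x <-> K' x.

(** The chord cut on the common section by the hyperplane of [v] lies in [K'] as well, so its
    translate by [- t v] lies in [K]. *)
Lemma agree_shift v a : dotv v v = 1 -> dotv u a = 1 -> dotv v a = 1 -> K a ->
  K (a - t v).
Proof. by move=> vv ua va /agree /(tp_shift tp vv va); exact. Qed.

(** If [t v] is parallel to the hyperplane of [u], the translate of the chord stays in that
    hyperplane and the translation can be repeated forever, against compactness. *)
Lemma horizontal_shift_eq0 v a : dotv v v = 1 -> dotv u a = 1 -> dotv v a = 1 ->
  K a -> dotv u (t v) = 0 -> t v = 0.
Proof.
move=> vv ua va Ka ut; apply: (compact_ray_eq0 (a := a) (tp_compact tp)).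
elim=> [|k IH]; first by rewrite scale0r subr0.
have -> : a - k.+1%:R *: t v = (a - k%:R *: t v) - t v.
  by rewrite -natr1 scalerDl scale1r opprD addrA.
apply: agree_shift => //; rewrite !dotE ?ut ?(tp_perp tp) ?ua ?va //; ring.
Qed.

(** From [x], the line in direction [- t v] meets the hyperplane of [u] at a point [y]. Once [y] is
    known to lie in [K], so does [y - t v], and [x - t v] lies between [x] and [y - t v]. *)
Lemma upward_shift_sub v a x : dotv v v = 1 -> dotv u a = 1 -> dotv v a = 1 ->
  K a -> 0 < dotv u (t v) -> K x -> dotv v x = 1 -> 1 <= dotv u x -> K' x.
Proof.
move=> vv ua va Ka ut Kx vx ux; apply/(tp_shift tp vv vx).
pose s := (dotv u x - 1) / dotv u (t v).
have s0 : 0 <= s by rewrite divr_ge0 ?subr_ge0 // ltW.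
have ss : s * dotv u (t v) = dotv u x - 1 by rewrite divfK // gt_eqF.
have vt := tp_perp tp vv.
have s1 : 0 < 1 + s by lra.
have s10 : 1 + s != 0 by rewrite gt_eqF.
pose r := s / (1 + s).
have r01 : 0 <= r < 1.
  by rewrite divr_ge0 ?(ltW s1) //= ltr_pdivrMr // mul1r; lra.
pose y := x - s *: t v.
pose A := K `&` (hyperplane u 1 `&` hyperplane v 1).
have [Ky _] : A y.
  apply: (@closed_contraction _ _ A y a r) => //.
    apply: closedI; first exact: compact_closed_rV (tp_compact tp).
    by apply: closedI; exact: closed_hyperplane.
  (* The contraction is [(1 - r) y + r b = (1 - r) x + r (b - t v)]. The right side is in [K] by
     convexity, the left side is in both hyperplanes, so the chord [A] is mapped into itself. *)
  move=> b [Kb [ub vb]]; split; last first.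
    by rewrite /hyperplane /= !dotE vx vt ub vb ss; split; ring.
  have := tp_segment tp Kx (agree_shift vv ub vb Kb) (l := r).
  case/andP: r01 => r0 r1; rewrite r0 ltW //; move/(_ isT).
  congr K; apply/rowP => j; rewrite !mxE /r; field; exact: s10.
have uy : dotv u y = 1 by rewrite !dotE ss; ring.
have vy : dotv v y = 1 by rewrite !dotE vx vt; ring.
have := tp_segment tp Kx (agree_shift vv uy vy Ky) (l := 1 - r).
have -> : 0 <= 1 - r <= 1 by case/andP: r01 => *; apply/andP; split; lra.
move/(_ isT); congr K; apply/rowP => j; rewrite !mxE /r; field; exact: s10.
Qed.

Lemma shift_downward v a x : dotv v v = 1 -> dotv u a = 1 -> dotv v a = 1 ->
  K a -> K x -> ~ K' x -> dotv v x = 1 -> 1 <= dotv u x -> dotv u (t v) < 0.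
Proof.
move=> vv ua va Ka Kx K'x vx ux; rewrite ltNge le_eqVlt; apply/negP => /orP[/eqP ut|ut].
  have t0 := horizontal_shift_eq0 vv ua va Ka (esym ut).
  by apply/K'x/(tp_shift tp vv vx); rewrite t0 subr0.
exact/K'x/(upward_shift_sub vv ua va Ka ut).
Qed.

(* The segment from [x] to the point of tangency [v] crosses the hyperplane of [u]. *)
Lemma crossing_point v x : dotv v v = 1 -> dotv u v < 1 -> K x -> dotv v x = 1 ->
  1 <= dotv u x -> exists a, [/\ K a, dotv u a = 1 & dotv v a = 1].
Proof.
move=> vv uv Kx vx ux.
pose l := (1 - dotv u v) / (dotv u x - dotv u v).
have d0 : 0 < dotv u x - dotv u v by rewrite subr_gt0 (lt_le_trans uv).
have ll : l * (dotv u x - dotv u v) = 1 - dotv u v by rewrite divfK // gt_eqF.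
have Kv : K v.
  by apply: (tp_ball tp); rewrite vv expr_ge1 ?lerDl ?addr_ge0 ?ltW // (tp_q tp).
exists ((1 - l) *: v + l *: x); split.
- apply: (tp_segment tp) => //; rewrite divr_ge0 ?subr_ge0 ?(ltW uv) ?(ltW d0) //=.
  + by rewrite ler_pdivrMr // mul1r lerD2r.
  + by rewrite -subr_ge0 ltW.
- by rewrite !dotE; move: ll; set w := dotv u v; set z := dotv u x => ll; nra.
- by rewrite !dotE vv vx; ring.
Qed.

Lemma top_point v : dotv v v = 1 -> exists x, [/\ K x, dotv v x = 1 &
  forall y, K y -> dotv v y = 1 -> dotv u y <= dotv u x].
Proof.
move=> vv.
have Kv : K v.
  by apply: (tp_ball tp); rewrite vv expr_ge1 ?lerDl ?addr_ge0 ?ltW // (tp_q tp).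
have [||x [Kx vx] hx] := @compact_argmax R n (K `&` hyperplane v 1) u.
- by exists v.
- exact: compact_hyperplane (tp_compact tp).
by exists x; split=> // y Ky vy; apply: hx.
Qed.

(** If [x] were in [K'], then [x - t v] would be a higher point of the same section of [K]. *)
Lemma top_notin v x : dotv v v = 1 -> dotv u (t v) < 0 -> K x -> dotv v x = 1 ->
  (forall y, K y -> dotv v y = 1 -> dotv u y <= dotv u x) -> ~ K' x.
Proof.
move=> vv ut Kx vx hx /(tp_shift tp vv vx) /hx.
by rewrite !dotE (tp_perp tp) // subr0 => /(_ vx); lra.
Qed.

End AgreeingSection.
End TangentPair.

(** * Orthogonal unit vectors and one-parameter families of tangent hyperplanes *)

Section Orthonormal.
Variables (R : realType) (n : nat).
Implicit Types x y e : 'rV[R]_n.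

Lemma mulmx_tr_dotv x y : x *m y^T = (dotv x y)%:M.
Proof.
apply/rowP => j; rewrite !mxE (ord1 j) eqxx mulr1n.
by apply: eq_bigr => i _; rewrite mxE.
Qed.

Lemma exists_unit_orthogonal (m : nat) (A : 'M[R]_(m, n)) : (m < n)%N ->
  exists2 e : 'rV[R]_n, dotv e e = 1 & e *m A^T = 0.
Proof.
move=> mn; pose f := nz_row (kermx A^T).
have f0 : f != 0.
  rewrite nz_row_eq0 kermx_eq0 -row_leq_rank -ltnNge.
  by rewrite (leq_ltn_trans (rank_leq_col _)).
have fA : f *m A^T = 0 by apply/sub_kermxP; exact: nz_row_sub.
exists ((Num.sqrt (dotv f f))^-1 *: f); first exact: normalize_dotvv.
by rewrite -scalemxAl fA scaler0.
Qed.

Lemma exists_unit_orthogonal2 x y : (3 <= n)%N ->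
  exists e, [/\ dotv e e = 1, dotv x e = 0 & dotv y e = 0].
Proof.
move=> n3; have [e ee] := exists_unit_orthogonal (col_mx x y) n3.
rewrite tr_col_mx mul_mx_row -[0]row_mx0 => /eq_row_mx[].
rewrite !mulmx_tr_dotv => /rowP/(_ ord0) ex /rowP/(_ ord0) ey.
exists e; split=> //; rewrite dotvC.
  by move: ex; rewrite !mxE eqxx mulr1n.
by move: ey; rewrite !mxE eqxx mulr1n.
Qed.

End Orthonormal.

Section TangentDirections.
Variables (R : realType) (n : nat).
Variables (u nu : 'rV[R]_n).
Hypotheses (uu : dotv u u = 1) (nn : dotv nu nu = 1) (un : dotv u nu = 0).
Implicit Types (x : 'rV[R]_n) (r : R).

(* Parametrises the unit vectors of the plane spanned by [u] and [nu]; the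
   hyperplanes tangent to the unit ball at [u] and at [tdir r] meet along
   [dotv nu x = r]. *)
Definition tdir r : 'rV[R]_n := (1 + r ^+ 2)^-1 *: ((1 - r ^+ 2) *: u + (2 * r) *: nu).

Lemma tdir_den r : 1 + r ^+ 2 != 0.
Proof. by rewrite gt_eqF // ltr_pwDl // sqr_ge0. Qed.

Lemma tdir_unit r : dotv (tdir r) (tdir r) = 1.
Proof.
rewrite /tdir !dotE (dotvC nu u) uu nn un; field; exact: tdir_den.
Qed.

Lemma dotv_tdir_u r : dotv u (tdir r) = (1 - r ^+ 2) / (1 + r ^+ 2).
Proof. by rewrite /tdir !dotE uu un; field; exact: tdir_den. Qed.

Lemma dotv_tdir_lt1 r : r != 0 -> dotv u (tdir r) < 1.
Proof.
move=> r0; have r2 : 0 < r ^+ 2 by rewrite exprn_even_gt0.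
by rewrite dotv_tdir_u ltr_pdivrMr; lra.
Qed.

Lemma tdirP r x : dotv (tdir r) x = 1 <->
  2 * r * dotv nu x = 2 * r ^+ 2 - (dotv u x - 1) * (1 - r ^+ 2).
Proof.
rewrite /tdir !dotE; have d := tdir_den r; set a := dotv u x; set b := dotv nu x.
split=> h.
  by move/(congr1 ( *%R (1 + r ^+ 2))): h; rewrite mulVKf // mulr1; lra.
apply: (mulfI d); rewrite mulVKf // mulr1; lra.
Qed.

(** The larger root [r] of [(2 + z) r^2 - 2 b r - z = 0]. By [tdirP], this is the parameter of a
    tangent hyperplane through a point with [dotv nu x = b] at height [z] above the hyperplane of
    [u]. *)
Definition troot (b z : R) := (b + Num.sqrt (b ^+ 2 + z * (2 + z))) / (2 + z).

Lemma troot_gt0 b z : 0 < z -> 0 < troot b z.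
Proof.
move=> z0; rewrite divr_gt0 //; last by lra.
have : `|b| < Num.sqrt (b ^+ 2 + z * (2 + z)).
  by rewrite -sqrtr_sqr ltr_sqrt; nra.
by have := ler_norm (- b); rewrite normrN; lra.
Qed.

Lemma dotv_tdir_troot x : 1 < dotv u x ->
  dotv (tdir (troot (dotv nu x) (dotv u x - 1))) x = 1.
Proof.
set b := dotv nu x; set z := dotv u x - 1 => ux.
have z0 : 0 < z by rewrite subr_gt0.
apply/tdirP; rewrite -/b -/z /troot; set s := Num.sqrt _.
have ss : s ^+ 2 = b ^+ 2 + z * (2 + z) by rewrite sqr_sqrtr //; nra.
have z2 : 2 + z != 0 by rewrite gt_eqF // ltr_wpDr // ltW.
rewrite exprMn sqrrD ss; field: ss => //.
Qed.

(** The limit is the positive part of [b]. As the point sinks to the hyperplane of [u], the tangent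
    hyperplane through it tends to that of [u] when [b] is negative, and to a different one when [b]
    is positive. *)
Lemma cvg_troot (T : Type) (F : set_system T) {FF : ProperFilter F}
    (b_ z_ : T -> R) b : b_ @ F --> b -> z_ @ F --> (0 : R) ->
  (fun i => troot (b_ i) (z_ i)) @ F --> (b + `|b|) / 2.
Proof.
move=> cb cz.
have -> : (b + `|b|) / 2 = troot b 0.
  by rewrite /troot mul0r !addr0 sqrtr_sqr.
have c2 : (fun i => 2 + z_ i) @ F --> (2 + 0 : R) by apply: cvgD => //; exact: cvg_cst.
apply: cvgM; last by apply: cvgV => //; rewrite addr0 pnatr_eq0.
apply: cvgD => //.
apply: (continuous_cvg _ (f := fun i => b_ i ^+ 2 + z_ i * (2 + z_ i))).
  exact: sqrt_continuous.
by apply: cvgD; exact: cvgM.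
Qed.

Lemma cvg_tdir (T : Type) (F : set_system T) {FF : ProperFilter F}
    (r_ : T -> R) r : r_ @ F --> r -> (fun i => tdir (r_ i)) @ F --> tdir r.
Proof.
move=> cr; have cr2 : (fun i => r_ i ^+ 2) @ F --> r ^+ 2 by exact: cvgM.
apply: cvgZ.
  apply: cvgV; first exact: tdir_den.
  by apply: cvgD => //; exact: cvg_cst.
apply: cvgD; apply: cvgZ; try exact: cvg_cst.
  by apply: cvgB => //; exact: cvg_cst.
by apply: cvgM => //; exact: cvg_cst.
Qed.

End TangentDirections.

(** * Exposed points, chords and the passage from one tangent hyperplane to the next *)

Section Propagation.
Variables (R : realType) (n : nat).
Implicit Types (x y u v a e nu : 'rV[R]_n).

Lemma compact_farthest (K : set 'rV[R]_n) o : K !=set0 -> compact K ->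
  exists2 p, K p & forall y, K y -> dotv (y - o) (y - o) <= dotv (p - o) (p - o).
Proof.
move=> K0 cK.
have [|p] := @EVT_max_rV R n (fun y => dotv (y - o) (y - o)) K K0 cK.
  by apply: continuous_subspaceT; exact: sqdist_continuous.
by rewrite inE => Kp h; exists p => // y Ky; apply: h; rewrite inE.
Qed.

(* A point [p] of the section farthest from a point far away in the direction
   opposite to [b] is exposed in a direction forming an acute angle with [b]. *)
Lemma exposed_point (K : set 'rV[R]_n) u b : compact K -> dotv u u = 1 -> K u ->
  dotv u b = 1 -> b != u ->
  exists nu p, [/\ dotv nu nu = 1, dotv u nu = 0, dotv nu b < 0,
    K p /\ dotv u p = 1 &
    forall y, K y -> dotv u y = 1 -> dotv nu y <= dotv nu p -> y = p].
Proof.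
move=> cK uu Ku ub bu; have [g gE] : exists g, g = b - u by exists (b - u).
have gg : 0 < dotv g g by rewrite dotvv_gt0 // gE subr_eq0.
have ug : dotv u g = 0 by rewrite gE !dotE ub uu subrr.
have [C C0 hC] := compact_dotv_bounded g cK.
(* With this [s], the point [o] is so far behind that [dotv g (y - o)] is at least 1 for every [y]
   in [K]. *)
pose s := (C + 1) / dotv g g; pose o := u - s *: g.
have sg : s * dotv g g = C + 1 by rewrite divfK // gt_eqF.
have [||p [Kp up] hp] := @compact_farthest (K `&` hyperplane u 1) o.
- by exists u.
- exact: compact_hyperplane.
have {}up : dotv u p = 1 by exact: up.
have [D DE] : exists D, D = p - o by exists (p - o).
have gD : 0 < dotv g D.
  have := hC _ Kp; rewrite ler_norml => /andP[h _].
  by rewrite DE /o !dotE sg (dotvC g u) ug; lra.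
have D0 : D != 0 by apply: contraTneq gD => ->; rewrite dotv0 ltxx.
have uD : dotv u D = 0 by rewrite DE /o !dotE up uu ug; ring.
set k := (Num.sqrt (dotv D D))^-1.
have k0 : 0 < k by rewrite invr_gt0 sqrtr_gt0 dotvv_gt0.
exists (- (k *: D)), p; split=> //.
- by rewrite dotvNl dotvNr opprK; exact: normalize_dotvv.
- by rewrite !dotE uD mulr0 oppr0.
- have -> : b = g + u by rewrite gE subrK.
  by have := mulr_gt0 k0 gD; rewrite !dotE (dotvC D u) uD (dotvC D g); lra.
move=> y Ky uy; rewrite !dotE lerN2 ler_pM2l // => Dy.
have [e eE] : exists e, e = y - p by exists (y - p).
have De : 0 <= dotv D e by rewrite eE !dotE subr_ge0.
apply/eqP; rewrite -subr_eq0 -dotvv_eq0 eq_le dotvv_ge0 andbT -eE.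
(* Since [dotv D e] is nonnegative, [D + e] is longer than [D] unless [e = 0], whereas [p] is
   farthest from [o]. *)
have := hp y (conj Ky uy); rewrite -DE.
have -> : y - o = D + e by rewrite DE eE; apply/rowP => j; rewrite !mxE; ring.
by rewrite !dotE (dotvC e D); lra.
Qed.

Section Chords.
Variables (K K' : set 'rV[R]_n) (q : R) (t c : 'rV[R]_n -> 'rV[R]_n).
Hypothesis tp : tangent_pair K K' q t c.
Variable u : 'rV[R]_n.
Hypothesis uu : dotv u u = 1.
Hypothesis agree : forall x, dotv u x = 1 -> K x <-> K' x.

Let q0 : 0 < q := tp_q tp.

Lemma tp_ball_unit v w (k : R) : dotv v v = 1 -> dotv w w = 1 -> `|k| <= q ->
  K (v + k *: w).
Proof.
move=> vv ww kq; apply: (tp_ball tp).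
have := dotv_le1 vv ww; rewrite !dotE vv ww (dotvC w v) !ler_norml.
move: kq; rewrite ler_norml => /andP[k1 k2] /andP[d1 d2].
have : (k * dotv v w) <= q.
  have [k0|/ltW k0] := lerP 0 k.
    by rewrite (le_trans _ k2) // ler_piMr.
  by rewrite (le_trans _ (_ : - k <= q)) //; nra.
nra.
Qed.

(* The segment of half-length [q] through [c v] and the translate by [- t v] of
   the common section lie on both sides of the hyperplane of [u]. *)
Lemma long_chord v e a : dotv v v = 1 -> dotv u (c v) < 1 -> dotv u (t v) < 0 ->
  K a -> dotv u a = 1 -> dotv v a = 1 ->
  dotv e e = 1 -> dotv u e = 0 -> dotv v e = 0 ->
  exists a1 a2, [/\ K a1, K a2, dotv u a1 = 1 /\ dotv u a2 = 1,
    dotv v a1 = 1 /\ dotv v a2 = 1 & dotv e a1 + q *+ 2 <= dotv e a2].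
Proof.
move=> vv uc ut Ka ua va ee ue ve.
(* The point is the midpoint of [v + s q e] and of the reflection of [v - s q e] in [c v]. *)
have Kc (s : R) : `|s| = 1 -> K (c v + (s * q) *: e).
  move=> s1.
  have sq : `|s * q| <= q by rewrite normrM s1 mul1r ger0_norm // ltW.
  have K1 := tp_ball_unit vv ee sq.
  have K2 : K (v + (- (s * q)) *: e) by apply: tp_ball_unit; rewrite ?normrN.
  have := tp_sym tp vv _ K2; rewrite !dotE vv ve mulr0 addr0 => /(_ erefl) K3.
  have /(_ _) := tp_segment tp K1 K3 (l := 2^-1).
  have -> : 0 <= (2^-1 : R) <= 1 by apply/andP; split; lra.
  by move/(_ isT); congr K; apply/rowP => j; rewrite mulr2n !mxE; field.
have cA : compact (K `&` hyperplane u 1 `&` hyperplane v 1).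
  by do 2 apply: compact_hyperplane; exact: tp_compact tp.
have A0 : K `&` hyperplane u 1 `&` hyperplane v 1 !=set0 by exists a.
have [a2 [[Ka2 ua2] va2] h2] := compact_argmax e A0 cA.
have [a1 [[Ka1 ua1] va1] h1] := compact_argmax (- e) A0 cA.
exists a1, a2; split=> //.
pose z := dotv u (c v); pose s := dotv u (t v).
(* The weight at which a segment from height [1 - s], above the hyperplane of [u], to height [z],
   below it, crosses that hyperplane. *)
pose l := - s / (1 - s - z).
have den : 0 < 1 - s - z by rewrite /z /s; lra.
have lden : l * (1 - s - z) = - s by rewrite divfK // gt_eqF.
have l0 : 0 < l by rewrite divr_gt0 // oppr_gt0.
have l1 : l < 1 by rewrite ltr_pdivrMr // mul1r /z /s; lra.
have Al b (k : R) : `|k| = 1 -> K b -> dotv u b = 1 -> dotv v b = 1 ->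
  (K `&` hyperplane u 1 `&` hyperplane v 1)
    ((1 - l) *: (b - t v) + l *: (c v + (k * q) *: e)).
  move=> k1 Kb ub vb; split; first split.
  - apply: (tp_segment tp); [|exact: Kc|by rewrite !ltW].
    exact: (agree_shift tp agree).
  - by rewrite /hyperplane /= !dotE ub ue -/s -/z; move: lden; nra.
  - by rewrite /hyperplane /= !dotE vb ve (tp_perp tp vv) (tp_center tp vv); ring.
have := h2 _ (Al a2 1 (normr1 _) Ka2 ua2 va2).
have := h1 _ (Al a1 (-1) (normrN1 _) Ka1 ua1 va1).
rewrite !dotE ee; set E1 := dotv e a1; set E2 := dotv e a2.
set T := dotv e (t v); set C := dotv e (c v) => H1 H2.
(* Adding the two extremality inequalities gives [E2 - E1 >= (1 - l) (E2 - E1) + 2 l q]. *)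
have : l * (E1 + q *+ 2) <= l * E2 by rewrite mulr2n; nra.
by rewrite ler_pM2l.
Qed.

(** This tangent hyperplane meets that of [u] in a line (a flat in higher dimension) supporting the
    section at [p]. If [x] were higher, the segment from the point of tangency [v] to [x] would
    cross the section on this flat. As [v - q nu] is in [K], the crossing point could be pushed
    further along [- nu] within the section, beyond the minimum at [p]. *)
Lemma supporting_tdir nu p x : dotv nu nu = 1 -> dotv u nu = 0 ->
  (forall y, K y -> dotv u y = 1 -> dotv nu p <= dotv nu y) -> dotv nu p < 0 ->
  K x -> dotv (tdir u (- nu) (- dotv nu p)) x = 1 -> dotv u x <= 1.
Proof.
move=> nn un hp p0 Kx vx; rewrite leNgt; apply/negP => ux.
set h := - dotv nu p in vx.
have [v vE] : exists v, v = tdir u (- nu) h by exists (tdir u (- nu) h).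
rewrite -vE in vx.
have h0 : 0 < h by rewrite oppr_gt0.
have nn' : dotv (- nu) (- nu) = 1 by rewrite !dotE opprK.
have un' : dotv u (- nu) = 0 by rewrite dotvNr un oppr0.
have vv : dotv v v = 1 by rewrite vE; exact: tdir_unit.
have uv : dotv u v < 1 by rewrite vE; apply: dotv_tdir_lt1 => //; rewrite gt_eqF.
pose l := (1 - dotv u v) / (dotv u x - dotv u v).
have d0 : 0 < dotv u x - dotv u v by lra.
have ll : l * (dotv u x - dotv u v) = 1 - dotv u v by rewrite divfK // gt_eqF.
have l0 : 0 < l by rewrite divr_gt0 // subr_gt0.
have l1 : l < 1 by rewrite ltr_pdivrMr // mul1r ltrD2r.
pose g := (1 - l) *: v + l *: x.
have ug : dotv u g = 1 by rewrite !dotE; lra.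
have vg : dotv v g = 1 by rewrite !dotE vv vx; ring.
have ng : dotv nu g = - h.
  move: vg; rewrite vE => /tdirP; rewrite ug subrr mul0r subr0 dotvNl => E.
  apply: (mulfI (_ : 2 * h != 0)); first by rewrite mulf_neq0 ?pnatr_eq0 ?gt_eqF.
  by lra.
have Kvq : K (v + (- q) *: nu).
  by apply: tp_ball_unit => //; rewrite normrN ger0_norm // ltW.
have Kg := tp_segment tp Kvq Kx (l := l).
have : K (g - ((1 - l) * q) *: nu).
  have -> : g - ((1 - l) * q) *: nu = (1 - l) *: (v + (- q) *: nu) + l *: x.
    by apply/rowP => j; rewrite !mxE; ring.
  by apply: Kg; rewrite !ltW.
have ug' : dotv u (g - ((1 - l) * q) *: nu) = 1.
  by rewrite dotvDr dotvNr dotvZr un ug; ring.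
move=> /hp/(_ ug'); rewrite dotvDr dotvNr dotvZr nn ng mulr1.
have : 0 < (1 - l) * q by rewrite mulr_gt0 // subr_gt0.
by rewrite /h; lra.
Qed.

(** One step of the propagation: a point of [K] outside [K'] and above the hyperplane of [u] carries
    the downward direction of the shift over to a tangent hyperplane through it, tilted towards any
    chosen [nu]. *)
Lemma next_tangent nu x : dotv nu nu = 1 -> dotv u nu = 0 -> K x -> ~ K' x ->
  1 < dotv u x -> forall v, v = tdir u nu (troot (dotv nu x) (dotv u x - 1)) ->
  [/\ dotv v v = 1, dotv v x = 1, dotv u (t v) < 0 &
      exists a, [/\ K a, dotv u a = 1 & dotv v a = 1]].
Proof.
move=> nn un Kx K'x ux v vE.
have r0 : 0 < troot (dotv nu x) (dotv u x - 1) by rewrite troot_gt0 // subr_gt0.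
have vv : dotv v v = 1 by rewrite vE; exact: tdir_unit.
have vx : dotv v x = 1 by rewrite vE; exact: dotv_tdir_troot.
have uv : dotv u v < 1 by rewrite vE; apply: dotv_tdir_lt1 => //; rewrite gt_eqF.
have [a [Ka ua va]] := crossing_point tp vv uv Kx vx (ltW ux).
split=> //; last by exists a.
exact: (shift_downward tp agree vv ua va Ka Kx K'x vx (ltW ux)).
Qed.

End Chords.
End Propagation.

(** * Downward shifts do not accumulate at a common section *)

Lemma near_choice (T : Type) (V : Type) (F : set_system T) {FF : ProperFilter F}
    (y0 : V) (P : T -> V -> Prop) : (\forall i \near F, exists y, P i y) ->
  exists y_ : T -> V, \forall i \near F, P i (y_ i).
Proof.
move=> h.
have /choice[y_ hy] : forall i, exists y, (exists z, P i z) -> P i y.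
  move=> i; have [[y Py]|nP] := pselect (exists y, P i y); first by exists y.
  by exists y0 => /nP.
by exists y_; apply: filterS h.
Qed.

Lemma ler_cvg_filter (R : realType) (T : Type) (F : set_system T)
    {FF : ProperFilter F} (f g : T -> R) (l m : R) : f @ F --> l -> g @ F --> m ->
  (\forall i \near F, f i <= g i) -> l <= m.
Proof.
move=> fl gm fg; rewrite -subr_ge0; apply: (cvgr_to_ge (cvgB gm fl)).
by apply: filterS fg => i; rewrite subr_ge0.
Qed.

Section Accumulation.
Variables (R : realType) (n : nat).
Variables (K K' : set 'rV[R]_n) (q : R) (t c : 'rV[R]_n -> 'rV[R]_n).
Hypothesis tp : tangent_pair K K' q t c.
Variable u : 'rV[R]_n.
Hypothesis uu : dotv u u = 1.
Hypothesis agree : forall x, dotv u x = 1 -> K x <-> K' x.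
Variables (T : Type) (U : set_system T).
Context {UU : UltraFilter U}.

Let PU : ProperFilter U := ultra_proper.

Lemma cvg_section (v_ x_ : T -> 'rV[R]_n) v x : v_ @ U --> v -> x_ @ U --> x ->
  (\forall i \near U, dotv (v_ i) (x_ i) = 1) -> dotv v x = 1.
Proof.
move=> cv cx h; have cvx := cvg_dotv (FF := PU) cv cx; apply/eqP; rewrite eq_le.
apply/andP; split; [apply: (cvgr_to_le cvx)|apply: (cvgr_to_ge cvx)];
  by apply: filterS h => i ->.
Qed.

(** The highest points of the sections at [v_ i] are outside [K'] by [top_notin]. They are strictly
    above the hyperplane of [u] because the translated chord of [agree_shift] is. *)
Lemma cvg_tops (v_ : T -> 'rV[R]_n) v : v_ @ U --> v ->
  (\forall i \near U, [/\ dotv (v_ i) (v_ i) = 1, dotv u (t (v_ i)) < 0 &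
    exists a, [/\ K a, dotv u a = 1 & dotv (v_ i) a = 1]]) ->
  exists x_ x, [/\ x_ @ U --> x, K x, dotv v x = 1 &
    \forall i \near U, [/\ K (x_ i), ~ K' (x_ i), dotv (v_ i) (x_ i) = 1,
      1 < dotv u (x_ i) & forall y, K y -> dotv (v_ i) y = 1 ->
        dotv u y <= dotv u (x_ i)]].
Proof.
move=> cv h.
have hex : \forall i \near U, exists x, [/\ K x, ~ K' x, dotv (v_ i) x = 1,
    1 < dotv u x & forall y, K y -> dotv (v_ i) y = 1 -> dotv u y <= dotv u x].
  apply: filterS h => i [vv ut [a [Ka ua va]]].
  have [x [Kx vx hx]] := top_point tp u vv; exists x; split=> //.
    exact: (top_notin tp vv ut Kx vx hx).
  have := hx _ (agree_shift tp agree vv ua va Ka).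
  by rewrite !dotE va ua (tp_perp tp vv) subr0 => /(_ erefl); lra.
have [x_ hx] := near_choice (FF := PU) 0 hex.
have [|x Kx cx] := ultra_compact_cvg (f := x_) UU (tp_compact tp).
  by apply: filterS hx => i [].
exists x_, x; split=> //; apply: (cvg_section cv cx).
by apply: filterS hx => i [].
Qed.

Lemma near_common_point (v_ : T -> 'rV[R]_n) :
  (\forall i \near U, dotv (v_ i) (v_ i) = 1) -> v_ @ U --> u ->
  \forall i \near U, exists a, [/\ K a, dotv u a = 1 & dotv (v_ i) a = 1].
Proof.
move=> v1 cv; have q0 := tp_q tp.
have cuv : (fun i => dotv u (v_ i)) @ U --> (1 : R).
  by rewrite -[X in _ --> X]uu; apply: cvg_dotv => //; exact: cvg_cst.
(* The shortest common point of the two tangent hyperplanes is [(u + v_ i) / (1 + s)], of squared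
   length [2 / (1 + s)]. It lies in the ball of radius [1 + q] once [s] exceeds [k]. *)
pose k : R := 2 / (1 + q) ^+ 2 - 1.
have q2 : 0 < (1 + q) ^+ 2 by rewrite exprn_gt0 // addr_gt0.
have k1 : k < 1 by rewrite ltrBlDr ltr_pdivrMr //; nra.
have hk : \forall i \near U, k < dotv u (v_ i) by exact: (cvgr_gt 1 cuv k k1).
apply: filterS2 v1 hk => i vv kuv; set s := dotv u (v_ i) in kuv.
have s1 : 0 < 1 + s.
  by apply: (@lt_trans _ _ (1 + k)); rewrite ?ltrD2l // /k addrC subrK divr_gt0.
exists ((1 + s)^-1 *: (u + v_ i)); split.
- apply: (tp_ball tp); rewrite !dotE uu vv (dotvC (v_ i) u) -/s.
  rewrite (_ : _ * _ = 2 / (1 + s)); last by field; rewrite gt_eqF.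
  rewrite ler_pdivrMr // mulrC -ler_pdivrMr //; rewrite /k in kuv; lra.
- by rewrite !dotE uu -/s mulVf // gt_eqF.
- by rewrite !dotE vv (dotvC (v_ i) u) -/s addrC mulVf // gt_eqF // addrC.
Qed.

Lemma no_downward_accumulation (v_ : T -> 'rV[R]_n) : (3 <= n)%N -> v_ @ U --> u ->
  ~ (\forall i \near U, dotv (v_ i) (v_ i) = 1 /\ dotv u (t (v_ i)) < 0).
Proof.
move=> n3 cv hv; have q0 := tp_q tp.
have hA : \forall i \near U, [/\ dotv (v_ i) (v_ i) = 1, dotv u (t (v_ i)) < 0 &
    exists a, [/\ K a, dotv u a = 1 & dotv (v_ i) a = 1]].
  have v1 : \forall i \near U, dotv (v_ i) (v_ i) = 1 by apply: filterS hv => i [].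
  by apply: filterS2 hv (near_common_point v1 cv) => i [].
have {hA} [x_ [b [cx Kb ub hx]]] := cvg_tops cv hA.
have Ku : K u by apply: (tp_ball tp); rewrite uu; nra.
(* The tops are outside [K'], hence at distance more than [1 + q] from the origin, and so is not
   their limit a unit vector. *)
have bu : b != u.
  apply/eqP => bu; have := cvg_dotv (FF := PU) cx cx; rewrite bu uu => cxx.
  have /(cvgr_to_ge cxx) : \forall i \near U, (1 + q) ^+ 2 <= dotv (x_ i) (x_ i).
    apply: filterS hx => i [_ K'x _ _ _]; rewrite leNgt; apply/negP => /ltW.
    by move/(tp_ball' tp).
  by nra.
have [nu [p [nn un nb [Kp up] hp]]] := exposed_point (tp_compact tp) uu Ku ub bu.
have cux : (fun i => dotv u (x_ i) - 1) @ U --> (0 : R).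
  rewrite -(subrr 1) -[X in _ --> X - _]ub; apply: cvgB; last exact: cvg_cst.
  by apply: cvg_dotv => //; exact: cvg_cst.
have cnx : (fun i => dotv nu (x_ i)) @ U --> dotv nu b.
  by apply: cvg_dotv => //; exact: cvg_cst.
(* The hyperplanes through the tops, tilted towards [nu], still converge to that of [u] because
   [dotv nu b] is negative. *)
pose r_ i := troot (dotv nu (x_ i)) (dotv u (x_ i) - 1).
have cr : r_ @ U --> (0 : R).
  have := cvg_troot (FF := PU) cnx cux; rewrite ltr0_norm // subrr mul0r; exact.
pose w_ i := tdir u nu (r_ i).
have cw : w_ @ U --> u.
  have := cvg_tdir (FF := PU) (u := u) (nu := nu) cr.
  rewrite {2}/tdir expr0n addr0 subr0 invr1 mulr0 scale0r !scale1r addr0; exact.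
have hw : \forall i \near U, [/\ dotv (w_ i) (w_ i) = 1, dotv u (t (w_ i)) < 0 &
    exists a, [/\ K a, dotv u a = 1 & dotv (w_ i) a = 1]].
  apply: filterS hx => i [Kx K'x _ ux _].
  by have [] := next_tangent tp uu agree nn un Kx K'x ux (erefl (w_ i)).
have [y_ [y [cy Ky uy hy]]] := cvg_tops cw hw.
(* Within the hyperplane of [w_ i], where [0 < r_ i < 1], a higher point has a smaller product with
   [nu]. Comparing the top [y_ i] with points approximating [z] gives the inequality in the limit,
   so [y] is the exposed point [p]. *)
have ymin z : K z -> dotv u z = 1 -> dotv nu y <= dotv nu z.
  move=> Kz uz.
  have wu : \forall i \near U, dotv (w_ i) (w_ i) = 1 by apply: filterS hw => i [].
  have [z_ cz hz] := section_lsc (FF := PU) (tp_segment tp) q0 (tp_ball tp) wu cw Kz uz.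
  have cny : (fun i => dotv nu (y_ i)) @ U --> dotv nu y.
    by apply: cvg_dotv => //; exact: cvg_cst.
  have cnz : (fun i => dotv nu (z_ i)) @ U --> dotv nu z.
    by apply: cvg_dotv => //; exact: cvg_cst.
  apply: (ler_cvg_filter cny cnz).
  have r1 : \forall i \near U, r_ i < 1 by exact: (cvgr_lt 0 cr _ ltr01).
  have r0 : \forall i \near U, 0 < r_ i.
    by apply: filterS hx => i [_ _ _ ux _]; rewrite troot_gt0 // subr_gt0.
  near=> i.
  have [Kyi _ wy _ top] : [/\ K (y_ i), ~ K' (y_ i), dotv (w_ i) (y_ i) = 1,
    1 < dotv u (y_ i) & forall y, K y -> dotv (w_ i) y = 1 ->
        dotv u y <= dotv u (y_ i)] by near: i.
  have [Kzi wz] : K (z_ i) /\ dotv (w_ i) (z_ i) = 1 by near: i.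
  have ri1 : r_ i < 1 by near: i.
  have ri0 : 0 < r_ i by near: i.
  have := top _ Kzi wz.
  move/tdirP: wy => wy; move/tdirP: wz => wz.
  move: wy wz; set zy := dotv u (y_ i); set zz := dotv u (z_ i) => wy wz zzy.
  have ri2 : 0 < 2 * r_ i by rewrite pmulr_rgt0.
  have sq1 : 0 <= 1 - r_ i ^+ 2 by rewrite subr_ge0 expr_le1 // ltW.
  have := mulr_ge0 (_ : 0 <= zy - zz) sq1; rewrite subr_ge0 => /(_ zzy) zz1.
  by rewrite -(ler_pM2l ri2); lra.
have yp : y = p by apply: hp => //; exact: ymin.
subst y.
have np : dotv nu p < 0.
  have K1 : K (u + (- q) *: nu).
    by apply: (tp_ball_unit tp) => //; rewrite normrN ger0_norm // ltW.
  have := ymin _ K1; rewrite !dotE uu un (dotvC nu u) un nn => h.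
  apply: le_lt_trans (h _) _; first by ring.
  by rewrite add0r mulr1 oppr_lt0.
have nn' : dotv (- nu) (- nu) = 1 by rewrite !dotE opprK.
have un' : dotv u (- nu) = 0 by rewrite dotvNr un oppr0.
have cuy : (fun i => dotv u (y_ i) - 1) @ U --> (0 : R).
  rewrite -(subrr 1) -[X in _ --> X - _]up; apply: cvgB; last exact: cvg_cst.
  by apply: cvg_dotv => //; exact: cvg_cst.
have cny : (fun i => dotv (- nu) (y_ i)) @ U --> - dotv nu p.
  by rewrite -dotvNl; apply: cvg_dotv => //; exact: cvg_cst.
pose h := - dotv nu p; have h0 : 0 < h by rewrite oppr_gt0.
(* Tilting towards [- nu] instead, the hyperplanes through the new tops converge to the tangent
   hyperplane at [v], which differs from that of [u] and supports the common section at [p]. *)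
pose s_ i := troot (dotv (- nu) (y_ i)) (dotv u (y_ i) - 1).
have cs : s_ @ U --> h.
  have hh : (h + `|h|) / 2 = h by rewrite gtr0_norm //; field.
  by rewrite -[X in _ --> X]hh; exact: cvg_troot.
pose z_ i := tdir u (- nu) (s_ i).
have cz : z_ @ U --> tdir u (- nu) h by exact: cvg_tdir.
have hz : \forall i \near U, [/\ dotv (z_ i) (z_ i) = 1, dotv u (t (z_ i)) < 0 &
    exists a, [/\ K a, dotv u a = 1 & dotv (z_ i) a = 1]].
  apply: filterS hy => i [Kyi K'y _ uyi _].
  by have [] := next_tangent tp uu agree nn' un' Kyi K'y uyi (erefl (z_ i)).
pose v := tdir u (- nu) h.
have vv : dotv v v = 1 by exact: tdir_unit.
have uv : dotv u v < 1 by apply: dotv_tdir_lt1 => //; rewrite gt_eqF.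
have Kunit w : dotv w w = 1 -> K w.
  by move=> ww; apply: (tp_ball tp); rewrite ww; nra.
have Kc2 : \forall i \near U, K (c (z_ i) *+ 2 - z_ i).
  by apply: filterS hz => i [zz _ _]; apply: (tp_sym tp) => //; exact: Kunit.
have [|d Kd cd] := ultra_compact_cvg (f := fun i => c (z_ i) *+ 2 - z_ i) UU
  (tp_compact tp); first exact: Kc2.
have vd : dotv v d = 1.
  apply: (cvg_section cz cd); apply: filterS hz => i [zz _ _].
  move: zz (tp_center tp zz) => /=; move: (z_ i) => w ww wc.
  by rewrite mulr2n !dotE wc ww; ring.
have ud := supporting_tdir tp uu nn un ymin np Kd vd.
(* The centre is the midpoint of [z_ i] and its reflection. In the limit the first is below the
   hyperplane of [u] and the second, [d], is not above it. *)
have uc : \forall i \near U, dotv u (c (z_ i)) < 1.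
  have ccz : (fun i => dotv u ((c (z_ i) *+ 2 - z_ i) + z_ i)) @ U --> dotv u (d + v).
    by apply: cvg_dotv; [exact: cvg_cst|exact: cvgD].
  have dv2 : dotv u (d + v) < 2 by rewrite dotvDr; lra.
  have hlt : \forall i \near U, dotv u ((c (z_ i) *+ 2 - z_ i) + z_ i) < 2.
    exact: (cvgr_lt _ ccz _ dv2).
  apply: filterS hlt => i.
  by rewrite subrK mulr2n dotvDr; lra.
(* Being orthogonal to [u] and [nu], the direction [e] is orthogonal to every [z_ i]; this is where
   [3 <= n] enters. *)
have [e [ee ue ne]] := exists_unit_orthogonal2 u nu n3.
have he : \forall i \near U, exists a : 'rV[R]_n * 'rV[R]_n,
    [/\ K a.1, K a.2, dotv u a.1 = 1 /\ dotv u a.2 = 1,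
    dotv (z_ i) a.1 = 1 /\ dotv (z_ i) a.2 = 1 & dotv e a.1 + q *+ 2 <= dotv e a.2].
  apply: filterS2 hz uc => i [zz ut [a [Ka ua za]]] ui.
  have ze : dotv (z_ i) e = 0.
    by rewrite /z_ /tdir !dotE ue ne; ring.
  have [a1 [a2 H]] := long_chord tp agree zz ui ut Ka ua za ee ue ze.
  by exists (a1, a2).
have [a_ ha] := near_choice (FF := PU) (0, 0) he.
(* A limit of chord endpoints lies in the common section and in the hyperplane of [v], so its
   product with [nu] is minimal and it equals [p]. Both endpoints thus tend to [p], although they
   stay [2 q] apart along [e]. *)
have lim_p (f : 'rV[R]_n * 'rV[R]_n -> 'rV[R]_n) :
    (\forall i \near U, [/\ K (f (a_ i)), dotv u (f (a_ i)) = 1 &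
      dotv (z_ i) (f (a_ i)) = 1]) -> (fun i => f (a_ i)) @ U --> p.
  move=> hf.
  have [|l Kl cl] := ultra_compact_cvg (f := fun i => f (a_ i)) UU (tp_compact tp).
    by apply: filterS hf => i [].
  have ul : dotv u l = 1.
    by apply: (cvg_section (cvg_cst u) cl); apply: filterS hf => i [].
  have vl : dotv v l = 1.
    by apply: (cvg_section cz cl); apply: filterS hf => i [].
  suff -> : p = l by [].
  apply/esym/hp => //; move: vl => /tdirP.
  rewrite ul subrr mul0r subr0 dotvNl => E.
  have : 2 * h * (h + dotv nu l) = 0 by lra.
  move/eqP; rewrite mulf_eq0 (gt_eqF (_ : 0 < 2 * h)) ?mulr_gt0 //= => /eqP.
  by rewrite /h; lra.
have c1 : (fun i => (a_ i).1) @ U --> p.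
  by apply: (lim_p fst); apply: filterS ha => i [? _ [? _] [? _] _]; split.
have c2 : (fun i => (a_ i).2) @ U --> p.
  by apply: (lim_p snd); apply: filterS ha => i [_ ? [_ ?] [_ ?] _]; split.
have : dotv e p + q *+ 2 <= dotv e p.
  apply: (@ler_cvg_filter _ _ _ PU (fun i => dotv e (a_ i).1 + q *+ 2)
    (fun i => dotv e (a_ i).2)).
  - by apply: cvgD; [apply: cvg_dotv => //; exact: cvg_cst|exact: cvg_cst].
  - by apply: cvg_dotv => //; exact: cvg_cst.
  - by apply: filterS ha => i [].
by rewrite mulr2n; lra.
Unshelve. all: by end_near. Qed.

End Accumulation.

(** * Continuity of the shift *)

Lemma ultra_continuous (V W : topologicalType) (f : V -> W) (x : V) :
  (forall U : set_system V, UltraFilter U -> U --> x -> f @ U --> f x) ->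
  {for x, continuous f}.
Proof.
move=> h A /= fxA; apply: contrapT => nA.
(* If the preimage of [A] is not a neighbourhood of [x], the traces of neighbourhoods on its
   complement form a proper filter; an ultrafilter above it violates the hypothesis. *)
pose G := within (~` (f @^-1` A)) (nbhs x).
have GP : ProperFilter G.
  apply: Build_ProperFilter_ex => P GP; apply: contrapT => nP; apply: nA.
  have {}GP : nbhs x [set y | ~ A (f y) -> P y] by exact: GP.
  by apply: filterS GP => y yP; apply: contrapT => /yP Py; apply: nP; exists y.
have [U [UU GU]] := ultraFilterLemma GP.
have Ux : U --> x by apply: cvg_trans GU _; exact: cvg_within.
have UA : U (f @^-1` A) by exact: h.
have UA' : U (~` (f @^-1` A)).
  have nT : nbhs x [set y | ~ A (f y) -> ~ A (f y)] by apply: filterE => y /=.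
  by apply: GU; exact: nT.
by have [y []] := filter_ex (filterI UA UA').
Qed.

Section ShiftContinuity.
Variables (R : realType) (n : nat).
Variables (K K' : set 'rV[R]_n) (q : R) (t c : 'rV[R]_n -> 'rV[R]_n).
Hypothesis tp : tangent_pair K K' q t c.
Implicit Types u v w x : 'rV[R]_n.

Lemma tp_unit v : dotv v v = 1 -> K v.
Proof. by move=> vv; apply: (tp_ball tp); rewrite vv; have := tp_q tp; nra. Qed.

(** One inclusion already determines the shift: translating by [s] into [K'] and back by [- t v]
    keeps the section of [K] inside itself, so compactness gives [s = t v]. *)
Lemma shift_unique v s : dotv v v = 1 -> dotv v s = 0 ->
  (forall x, K x -> dotv v x = 1 -> K' (x + s)) -> s = t v.
Proof.
move=> vv vs h; have vt := tp_perp tp vv.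
apply/esym/eqP; rewrite -subr_eq0; apply/eqP.
apply: (compact_ray_eq0 (a := v) (tp_compact tp)).
elim=> [|k IH]; first by rewrite scale0r subr0; exact: tp_unit.
set y := v - k%:R *: (t v - s) in IH.
have vy : dotv v y = 1 by rewrite !dotE vv vt vs; ring.
have vys : dotv v (y + s) = 1 by rewrite dotvDr vy vs addr0.
have /(tp_shift tp vv vys) := h _ IH vy.
by congr K; rewrite /y; apply/rowP => j; rewrite !mxE -natr1; ring.
Qed.

(** Compactness of [K'] provides a limit of the shifts. By [section_lsc] and closedness of [K'] this
    limit carries the section of [K] at [u] into [K'], so [shift_unique] identifies it. *)
Lemma cvg_shift (T : Type) (U : set_system T) (u_ : T -> 'rV[R]_n) u :
  UltraFilter U -> (\forall i \near U, dotv (u_ i) (u_ i) = 1) -> u_ @ U --> u ->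
  (fun i => t (u_ i)) @ U --> t u.
Proof.
move=> UU u1 cu; have PU : ProperFilter U by exact: ultra_proper.
have uu : dotv u u = 1 by apply: (cvg_section cu cu).
have Kut : \forall i \near U, K' (u_ i + t (u_ i)).
  apply: filterS u1 => i ui; apply/(tp_shift tp ui).
    by rewrite dotvDr (tp_perp tp ui) addr0.
  by rewrite addrK; exact: tp_unit.
have [w Kw cw] := ultra_compact_cvg (f := fun i => u_ i + t (u_ i)) UU
  (tp_compact' tp) Kut.
have ct : (fun i => t (u_ i)) @ U --> w - u.
  have : (fun i => (u_ i + t (u_ i)) - u_ i) @ U --> w - u by exact: cvgB.
  by under eq_fun do rewrite addrC addKr.
suff <- : w - u = t u by [].
apply: shift_unique => // [|x Kx ux].
  rewrite dotvDr dotvNr uu (cvg_section cu cw) ?subrr //.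
  by apply: filterS u1 => i ui; rewrite dotvDr (tp_perp tp ui) addr0.
have [x_ cx hx] := section_lsc (FF := PU) (tp_segment tp) (tp_q tp) (tp_ball tp)
  u1 cu Kx ux.
apply: (@closed_cvg _ _ U PU (fun i => x_ i + t (u_ i)) K').
- exact: compact_closed_rV (tp_compact' tp).
- apply: filterS2 u1 hx => i ui [Kxi uxi]; apply/(tp_shift tp ui).
    by rewrite dotvDr (tp_perp tp ui) addr0.
  by rewrite addrK.
- exact: cvgD.
Qed.

Lemma cvg_normalize (T : Type) (F : set_system T) {FF : ProperFilter F}
    (u_ : T -> 'rV[R]_n) u : u != 0 -> u_ @ F --> u ->
  (fun i => normalize (u_ i)) @ F --> normalize u.
Proof.
move=> u0 cu; apply: cvgZ => //; apply: cvgV.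
  by rewrite gt_eqF // sqrtr_gt0 dotvv_gt0.
apply: (continuous_cvg _ (f := fun i => dotv (u_ i) (u_ i))); first exact: sqrt_continuous.
exact: cvg_dotv.
Qed.

Lemma near_neq0 (T : Type) (F : set_system T) {FF : ProperFilter F}
    (u_ : T -> 'rV[R]_n) u : u != 0 -> u_ @ F --> u -> \forall i \near F, u_ i != 0.
Proof.
move=> u0 cu; have cuu := cvg_dotv (FF := FF) cu cu.
have h : \forall i \near F, 0 < dotv (u_ i) (u_ i).
  by apply: (cvgr_gt _ cuu); exact: dotvv_gt0.
by apply: filterS h => i; apply: contraTneq => ->; rewrite dotv0 ltxx.
Qed.

Lemma cvg_shift_normalize (T : Type) (U : set_system T) (u_ : T -> 'rV[R]_n) u :
  UltraFilter U -> u != 0 -> u_ @ U --> u ->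
  (fun i => t (normalize (u_ i))) @ U --> t (normalize u).
Proof.
move=> UU u0 cu; have PU : ProperFilter U by exact: ultra_proper.
apply: cvg_shift; last exact: cvg_normalize.
by apply: filterS (near_neq0 u0 cu) => i; exact: normalize_dotvv.
Qed.

Lemma shift_continuous u : u != 0 ->
  {for u, continuous (fun x => t (normalize x))}.
Proof. by move=> u0; apply: ultra_continuous => U UU cu; exact: cvg_shift_normalize. Qed.

End ShiftContinuity.

(** * The zero set of the shift is open, hence everything once non-empty *)

Section ShiftVanishing.
Variables (R : realType) (n : nat).
Hypothesis n3 : (3 <= n)%N.
Variables (K K' : set 'rV[R]_n) (q : R) (t c : 'rV[R]_n -> 'rV[R]_n).
Hypothesis tp : tangent_pair K K' q t c.
Implicit Types u v w x : 'rV[R]_n.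

(** Openness of the zero set. An ultrafilter decides the sign of [dotv u (t (v_ i))]: negative is
    impossible by accumulation, positive is the same case with [K] and [K'] exchanged, and a
    horizontal shift vanishes. *)
Lemma shift_zero_isolated (T : Type) (U : set_system T) (v_ : T -> 'rV[R]_n) u :
  UltraFilter U -> dotv u u = 1 -> t u = 0 ->
  (\forall i \near U, dotv (v_ i) (v_ i) = 1) -> v_ @ U --> u ->
  \forall i \near U, t (v_ i) = 0.
Proof.
move=> UU uu tu v1 cv; have PU : ProperFilter U by exact: ultra_proper.
have agree x : dotv u x = 1 -> K x <-> K' x.
  by move=> ux; have := tp_shift tp uu ux; rewrite tu subr0 => h; split=> /h.
have agree' x : dotv u x = 1 -> K' x <-> K x.
  by move=> /agree h; split=> /h.
have [Un|Un] := in_ultra_setVsetC [set i | dotv u (t (v_ i)) < 0] UU.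
  exfalso; apply: (no_downward_accumulation tp uu agree n3 cv).
  by apply: filterS2 v1 Un.
have [Up|Up] := in_ultra_setVsetC [set i | 0 < dotv u (t (v_ i))] UU.
  exfalso; apply: (no_downward_accumulation (tangent_pair_sym tp) uu agree' n3 cv).
  by apply: filterS2 v1 Up => i vv /= ut; rewrite dotvNr oppr_lt0.
apply: filterS3 (near_common_point tp uu v1 cv) v1 (filterI Un Up).
move=> i [a [Ka ua va]] vv [/= /negP h1 /negP h2].
apply: (horizontal_shift_eq0 tp agree vv ua va Ka).
by apply/eqP; rewrite eq_le !leNgt h1 h2.
Qed.

(** The segment from [u] to [w] avoids the origin, so normalising it gives a path on the sphere. The
    parameters with zero shift form a compact set, whose maximum must be 1 by openness. *)
Lemma shift_vanishes_off_antipode u w : dotv u u = 1 -> dotv w w = 1 -> t u = 0 ->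
  w != - u -> t w = 0.
Proof.
move=> uu ww tu wu.
pose p (l : R) := (1 - l) *: u + l *: w.
have p0 l : 0 <= l <= 1 -> p l != 0.
  move=> /andP[l0 l1]; rewrite -dotvv_eq0 gt_eqF //.
  have := dotvv_gt0 (_ : w + u != 0); rewrite addr_eq0 => /(_ wu).
  have := dotv_le1 uu ww; rewrite ler_norml => /andP[_].
  rewrite /p !dotE uu ww (dotvC w u); set s := dotv u w => s1 us.
  (* The squared length of [p l] is [(1 + s) / 2 + (1 - 2 l)^2 (1 - s) / 2], and [1 + s] is
     positive. *)
  have : 0 <= (1 - 2 * l) ^+ 2 * (1 - s) by rewrite mulr_ge0 ?sqr_ge0 ?subr_ge0.
  by lra.
have cp (U : set_system R) l : UltraFilter U -> U --> l -> p @ U --> p l.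
  move=> UU Ul; have PU : ProperFilter U by exact: ultra_proper.
  apply: cvgD; apply: cvgZ => //; try exact: cvg_cst.
  by apply: cvgB => //; exact: cvg_cst.
pose A := [set l : R | 0 <= l <= 1 /\ t (normalize (p l)) = 0].
have cA : compact A.
  rewrite compact_ultra => U UU UA; have PU : ProperFilter U by exact: ultra_proper.
  have U01 : U `[0, 1]%classic.
    by apply: filterS UA => l [l01 _] /=; rewrite in_itv.
  have [l /=] := ultra_compact_cvg (f := id) UU (@segment_compact _ 0 1) U01.
  rewrite in_itv /= => l01 cl; exists l; split=> //; split=> //.
  have ct := cvg_shift_normalize tp UU (p0 _ l01) (cp _ _ UU cl).
  apply/esym; apply: (cvg_unique (@norm_hausdorff _ _) _ ct).
  by apply: cvg_near_cst; apply: filterS UA => s [].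
have A0 : A 0.
  split; first by rewrite lexx ler01.
  rewrite /p subr0 scale1r scale0r addr0 /normalize uu sqrtr1 invr1 scale1r //.
have [|l] := @compact_EVT_max R R id A (ex_intro _ 0 A0) cA.
  by apply: continuous_subspaceT => x; exact: cvg_id.
rewrite inE => -[l01 tl] lmax.
have [l1|l1] := eqVneq l 1.
  move: tl; rewrite l1 /p subrr scale0r scale1r add0r.
  by rewrite /normalize ww sqrtr1 invr1 scale1r.
have ll1 : l < 1 by rewrite lt_neqAle l1; case/andP: l01.
have [U [UU GU]] := ultraFilterLemma (at_right_proper_filter l).
have PU : ProperFilter U by exact: ultra_proper.
have Ul : U --> l by apply: cvg_trans GU _; exact: cvg_within.
have near_r : \forall s \near U, l < s < 1.
  apply: GU; near=> s; apply/andP; split; near: s; first exact: nbhs_right_gt.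
  exact: nbhs_right_lt.
have sl s : l < s < 1 -> 0 <= s <= 1.
  by case/andP: l01 => l0 _ /andP[ls s1]; rewrite (le_trans l0) ?ltW.
have v1 : \forall s \near U, dotv (normalize (p s)) (normalize (p s)) = 1.
  by apply: filterS near_r => s /sl/p0; exact: normalize_dotvv.
have cn : (fun s => normalize (p s)) @ U --> normalize (p l).
  by apply: cvg_normalize; [exact: p0|exact: cp].
have h := shift_zero_isolated UU (normalize_dotvv (p0 _ l01)) tl v1 cn.
have [s [ts ls]] := filter_ex (filterI h near_r).
have /lmax : s \in A by rewrite inE; split => //; exact: sl.
by case/andP: ls => + _ => /lt_le_trans/[apply]; rewrite ltxx.
Unshelve. all: by end_near. Qed.

Lemma shift_vanishes u w : dotv u u = 1 -> dotv w w = 1 -> t u = 0 -> t w = 0.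
Proof.
move=> uu ww tu.
have [e [ee ue _]] := exists_unit_orthogonal2 u u n3.
have te : t e = 0.
  apply: (shift_vanishes_off_antipode uu ee tu); apply: contra_eqN ue => /eqP ->.
  by rewrite dotvNr uu oppr_eq0 oner_eq0.
have [wu|] := eqVneq w (- u); last exact: shift_vanishes_off_antipode.
apply: (shift_vanishes_off_antipode ee ww te); apply: contra_eqN ue => /eqP ew.
have -> : e = u by apply: oppr_inj; rewrite -ew.
by rewrite uu oner_eq0.
Qed.

End ShiftVanishing.

(** * Even tangent fields on the two-sphere *)

Section JointContinuity.
Variable R : realType.

(** Stated for arbitrary proper filters, so that it applies to ultrafilter limits and to
    neighbourhood filters alike. *)
Definition jointly_continuous (f : R -> R -> R) :=
  forall (T : Type) (F : set_system T) (a_ b_ : T -> R) (a b : R), ProperFilter F ->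
    a_ @ F --> a -> b_ @ F --> b -> (fun i => f (a_ i) (b_ i)) @ F --> f a b.

(* [csqrt_re x y + i y], that is [|z| + z], is an unnormalised square root of
   [z = x + i y]. *)
Definition csqrt_re (x y : R) := Num.sqrt (x ^+ 2 + y ^+ 2) + x.

Lemma csqrt_re_gt0 x y : 0 < x -> 0 < csqrt_re x y.
Proof. by move=> x0; rewrite ltr_wpDl // sqrtr_ge0. Qed.

Lemma csqrt_re_sqr x y :
  csqrt_re x y ^+ 2 - y ^+ 2 = 2 * csqrt_re x y * x.
Proof.
have := sqr_sqrtr (addr_ge0 (sqr_ge0 x) (sqr_ge0 y)).
by rewrite /csqrt_re; set s := Num.sqrt _ => ss; rewrite sqrrD ss; ring.
Qed.

(* Telescoping the quotients of consecutive values along a radius lifts [F] to a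
   continuous square root on the boundary circle, up to a positive factor and
   the rotation by the conjugate of [F 0]. *)
Lemma square_root_lift (F1 F2 : R -> R -> R) (N : nat) :
  jointly_continuous F1 -> jointly_continuous F2 ->
  0 < F1 0 0 ^+ 2 + F2 0 0 ^+ 2 ->
  (forall (i : nat) a b, (i < N)%N -> a ^+ 2 + b ^+ 2 = 1 ->
    let r := i%:R / N%:R in let s := i.+1%:R / N%:R in
    0 < F1 (s * a) (s * b) * F1 (r * a) (r * b) + F2 (s * a) (s * b) * F2 (r * a) (r * b)) ->
  (0 < N)%N ->
  exists G1 G2 : R -> R -> R,
    [/\ jointly_continuous G1, jointly_continuous G2 &
    forall a b, a ^+ 2 + b ^+ 2 = 1 -> exists2 k, 0 < k &
      G1 a b ^+ 2 - G2 a b ^+ 2 = k * (F1 a b * F1 0 0 + F2 a b * F2 0 0) /\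
      2 * G1 a b * G2 a b = k * (F2 a b * F1 0 0 - F1 a b * F2 0 0)].
Proof.
move=> c1 c2 F0 pos N0.
suff : forall i, (i <= N)%N -> exists G1 G2 : R -> R -> R,
    [/\ jointly_continuous G1, jointly_continuous G2 &
    forall a b, a ^+ 2 + b ^+ 2 = 1 -> exists2 k, 0 < k & let r := i%:R / N%:R in
      G1 a b ^+ 2 - G2 a b ^+ 2 =
        k * (F1 (r * a) (r * b) * F1 0 0 + F2 (r * a) (r * b) * F2 0 0) /\
      2 * G1 a b * G2 a b =
        k * (F2 (r * a) (r * b) * F1 0 0 - F1 (r * a) (r * b) * F2 0 0)].
  move=> /(_ N (leqnn N))[G1 [G2 [h1 h2 h]]]; exists G1, G2; split=> // a b ab.
  have [k k0] := h a b ab; rewrite /= divff ?pnatr_eq0 -?lt0n // !mul1r => H.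
  by exists k.
elim=> [_|i IH iN].
  exists (fun _ _ => 1), (fun _ _ => 0); split.
  - by move=> *; exact: cvg_cst.
  - by move=> *; exact: cvg_cst.
  move=> a b ab; exists (F1 0 0 ^+ 2 + F2 0 0 ^+ 2)^-1; first by rewrite invr_gt0.
  by rewrite /= !mul0r; split; field; rewrite gt_eqF.
have [G1 [G2 [h1 h2 h]]] := IH (ltnW iN).
pose r : R := i%:R / N%:R; pose s : R := i.+1%:R / N%:R.
(* Here [x + i y] is [F (s u)] times the conjugate of [F (r u)]. Its real part is positive, so its
   square root [w + i y], with [(w + i y)^2 = 2 w (x + i y)], depends continuously on [u]. *)
pose x a b := F1 (s * a) (s * b) * F1 (r * a) (r * b) +
              F2 (s * a) (s * b) * F2 (r * a) (r * b).
pose y a b := F2 (s * a) (s * b) * F1 (r * a) (r * b) -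
              F1 (s * a) (s * b) * F2 (r * a) (r * b).
pose w a b := csqrt_re (x a b) (y a b).
have scale (f : R -> R -> R) (l : R) : jointly_continuous f ->
    jointly_continuous (fun a b => f (l * a) (l * b)).
  by move=> cf T F a_ b_ a b FF ca cb; apply: cf; apply: cvgM => //; exact: cvg_cst.
have cx : jointly_continuous x.
  by move=> T F a_ b_ a b FF ca cb; apply: cvgD; apply: cvgM; apply: scale.
have cy : jointly_continuous y.
  by move=> T F a_ b_ a b FF ca cb; apply: cvgB; apply: cvgM; apply: scale.
have cw : jointly_continuous w.
  move=> T F a_ b_ a b FF ca cb; have cx' := cx T F a_ b_ a b FF ca cb.
  have cy' := cy T F a_ b_ a b FF ca cb.
  apply: cvgD => //.
  apply: (continuous_cvg _ (f := fun i => x (a_ i) (b_ i) ^+ 2 + y (a_ i) (b_ i) ^+ 2)).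
    exact: sqrt_continuous.
  by apply: cvgD; exact: cvgM.
exists (fun a b => G1 a b * w a b - G2 a b * y a b),
  (fun a b => G1 a b * y a b + G2 a b * w a b); split.
- by move=> T F a_ b_ a b FF ca cb; apply: cvgB; apply: cvgM;
    [exact: h1|exact: cw|exact: h2|exact: cy].
- by move=> T F a_ b_ a b FF ca cb; apply: cvgD; apply: cvgM;
    [exact: h1|exact: cy|exact: h2|exact: cw].
move=> a b ab; have [k k0 [E1 E2]] := h a b ab.
have x0 : 0 < x a b by exact: pos.
have w0 : 0 < w a b by exact: csqrt_re_gt0.
have W := csqrt_re_sqr (x a b) (y a b); rewrite -/(w a b) in W.
rewrite -/r in E1 E2; rewrite /= -/s.
have Fr0 : 0 < F1 (r * a) (r * b) ^+ 2 + F2 (r * a) (r * b) ^+ 2.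
  rewrite lt_neqAle addr_ge0 ?sqr_ge0 // andbT eq_sym; apply/eqP => /eqP.
  rewrite paddr_eq0 ?sqr_ge0 // !sqrf_eq0 => /andP[/eqP z1 /eqP z2].
  by move: x0; rewrite /x z1 z2 !mulr0 addr0 ltxx.
exists (k * (2 * w a b) * (F1 (r * a) (r * b) ^+ 2 + F2 (r * a) (r * b) ^+ 2)).
  by rewrite !mulr_gt0.
move: E1 E2 W; rewrite /x /y; set W := w a b.
set A1 := F1 (s * a) (s * b); set A2 := F2 (s * a) (s * b).
set B1 := F1 (r * a) (r * b); set B2 := F2 (r * a) (r * b).
set Z1 := F1 0 0; set Z2 := F2 0 0; set g1 := G1 a b; set g2 := G2 a b.
set Y := A2 * B1 - A1 * B2 => E1 E2 EW; split.
  have -> : (g1 * W - g2 * Y) ^+ 2 - (g1 * Y + g2 * W) ^+ 2 =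
    (g1 ^+ 2 - g2 ^+ 2) * (W ^+ 2 - Y ^+ 2) - (2 * g1 * g2) * (2 * W * Y) by ring.
  by rewrite E1 E2 EW /Y; ring.
have -> : 2 * (g1 * W - g2 * Y) * (g1 * Y + g2 * W) =
  (g1 ^+ 2 - g2 ^+ 2) * (2 * W * Y) + (2 * g1 * g2) * (W ^+ 2 - Y ^+ 2) by ring.
by rewrite E1 E2 EW /Y; ring.
Qed.

(* On the unit circle the hypothesis says [F (- u) = - u^2 * conj (F u)]. With
   [G] a square root of [F * conj (F 0)], the function
   [Im (F 0 * conj u * G u * G (- u))] would be odd and without zeros. *)
Lemma twisted_field_vanishes (F1 F2 : R -> R -> R) :
  jointly_continuous F1 -> jointly_continuous F2 ->
  (forall a b, a ^+ 2 + b ^+ 2 = 1 ->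
    F1 (- a) (- b) = - ((a ^+ 2 - b ^+ 2) * F1 a b + 2 * a * b * F2 a b) /\
    F2 (- a) (- b) = - (2 * a * b * F1 a b - (a ^+ 2 - b ^+ 2) * F2 a b)) ->
  exists a b, a ^+ 2 + b ^+ 2 <= 1 /\ F1 a b = 0 /\ F2 a b = 0.
Proof.
move=> c1 c2 twist; apply: contrapT => nz.
have pos a b : a ^+ 2 + b ^+ 2 <= 1 -> 0 < F1 a b ^+ 2 + F2 a b ^+ 2.
  move=> ab; rewrite lt_neqAle addr_ge0 ?sqr_ge0 // andbT eq_sym; apply/eqP => /eqP.
  rewrite paddr_eq0 ?sqr_ge0 // !sqrf_eq0 => /andP[/eqP z1 /eqP z2].
  by apply: nz; exists a, b.
have F0 : 0 < F1 0 0 ^+ 2 + F2 0 0 ^+ 2.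
  by apply: pos; rewrite expr0n addr0 ler01.
have [N N0 step] : exists2 N, (0 < N)%N & forall (i : nat) a b, (i < N)%N ->
    a ^+ 2 + b ^+ 2 = 1 -> let r := i%:R / N%:R in let s := i.+1%:R / N%:R in
    0 < F1 (s * a) (s * b) * F1 (r * a) (r * b) + F2 (s * a) (s * b) * F2 (r * a) (r * b).
  (* Uniform continuity by contradiction: bad radii and directions for every [N] have limits along
     an ultrafilter. Consecutive radii share their limit, so the products tend to the positive
     number [|F|^2] there. *)
  apply: contrapT => nN.
  have /choice[w hw] : forall N : nat, exists w : nat * (R * R),
      [/\ (w.1 < N.+1)%N, w.2.1 ^+ 2 + w.2.2 ^+ 2 = 1 &
      let r := w.1%:R / N.+1%:R in let s := w.1.+1%:R / N.+1%:R in
      let a := w.2.1 in let b := w.2.2 in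
      F1 (s * a) (s * b) * F1 (r * a) (r * b) + F2 (s * a) (s * b) * F2 (r * a) (r * b)
        <= 0].
    move=> N; apply: contrapT => nw; apply: nN; exists N.+1 => // i a b iN ab /=.
    by rewrite ltNge; apply/negP => le0; apply: nw; exists (i, (a, b)).
  have [U [UU Uoo]] := ultraFilterLemma (eventually_filter).
  have PU : ProperFilter U by exact: ultra_proper.
  pose a_ N := (w N).2.1; pose b_ N := (w N).2.2.
  pose r_ N : R := (w N).1%:R / N.+1%:R.
  pose s_ N : R := (w N).1.+1%:R / N.+1%:R.
  have ab N : a_ N ^+ 2 + b_ N ^+ 2 = 1 by have [] := hw N.
  have seg (z_ : nat -> R) : (forall N, -1 <= z_ N <= 1) -> exists l : R, z_ @ U --> l.
    move=> hz; have [|l _ cl] := ultra_compact_cvg (f := z_) UU (@segment_compact R (-1) 1).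
      by apply: filterE => N /=; rewrite in_itv; exact: hz.
    by exists l.
  have a01 N : -1 <= a_ N <= 1.
    by have := ab N; set x := a_ N; set y := b_ N => xy; apply/andP; split; nra.
  have b01 N : -1 <= b_ N <= 1.
    by have := ab N; set x := a_ N; set y := b_ N => xy; apply/andP; split; nra.
  have [a ca] := seg a_ a01; have [b cb] := seg b_ b01.
  have r01 N : -1 <= r_ N <= 1.
    have [wN _ _] := hw N; rewrite (@le_trans _ _ 0) ?divr_ge0 //=.
    by rewrite ler_pdivrMr // mul1r ler_nat ltnW.
  have [r cr] := seg r_ r01.
  have csr : (fun N => s_ N - r_ N) @ U --> (0 : R).
    suff : (fun N => s_ N - r_ N) @ \oo --> (0 : R) by apply: cvg_trans; exact: cvg_app.
    have -> : (fun N => s_ N - r_ N) = @harmonic R.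
      apply/funext => N; rewrite /s_ /r_ /harmonic /= -mulrBl -natr1 addrAC subrr add0r.
      by rewrite mul1r.
    exact: cvg_harmonic.
  have cs : s_ @ U --> r.
    have -> : s_ = (fun N => (s_ N - r_ N) + r_ N).
      by apply/funext => N; rewrite subrK.
    by rewrite -[X in _ --> X]add0r; exact: cvgD.
  have cF (f : R -> R -> R) (l_ : nat -> R) : jointly_continuous f -> l_ @ U --> r ->
      (fun N => f (l_ N * a_ N) (l_ N * b_ N)) @ U --> f (r * a) (r * b).
    by move=> cf cl; apply: cf; exact: cvgM.
  have abl : a ^+ 2 + b ^+ 2 = 1.
    have cab : (fun N => a_ N ^+ 2 + b_ N ^+ 2) @ U --> a ^+ 2 + b ^+ 2.
      by apply: cvgD; exact: cvgM.
    apply: (cvg_unique (@norm_hausdorff _ _) cab).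
    by apply: cvg_near_cst; apply: filterE => N; exact: ab.
  have rr : r ^+ 2 <= 1.
    have crr : (fun N => r_ N ^+ 2) @ U --> r ^+ 2 by exact: cvgM.
    apply: (cvgr_to_le crr); apply: filterE => N.
    by have /andP[r1 r2] := r01 N; nra.
  have /pos : (r * a) ^+ 2 + (r * b) ^+ 2 <= 1 by rewrite !exprMn -mulrDr abl mulr1.
  have lim : (fun N => F1 (s_ N * a_ N) (s_ N * b_ N) * F1 (r_ N * a_ N) (r_ N * b_ N) +
      F2 (s_ N * a_ N) (s_ N * b_ N) * F2 (r_ N * a_ N) (r_ N * b_ N)) @ U -->
      F1 (r * a) (r * b) ^+ 2 + F2 (r * a) (r * b) ^+ 2.
    by apply: cvgD; apply: cvgM; apply: cF.
  rewrite ltNge => /negP; apply; apply: (cvgr_to_le lim).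
  by apply: filterE => N; have [] := hw N.
have [G1 [G2 [g1 g2 sq]]] := square_root_lift c1 c2 F0 step N0.
pose X a b := G1 a b * G1 (- a) (- b) - G2 a b * G2 (- a) (- b).
pose Y a b := G1 a b * G2 (- a) (- b) + G2 a b * G1 (- a) (- b).
pose f1 := F1 0 0; pose f2 := F2 0 0.
(* [F 0 * conj u = (f1 a + f2 b) + i (f2 a - f1 b)] *)
pose H a b := (f1 * a + f2 * b) * Y a b + (f2 * a - f1 * b) * X a b.
have Hodd a b : H (- a) (- b) = - H a b by rewrite /H /X /Y !opprK; ring.
have H0 a b : a ^+ 2 + b ^+ 2 = 1 -> H a b != 0.
  move=> ab; apply/eqP => Hab.
  have ab' : (- a) ^+ 2 + (- b) ^+ 2 = 1 by rewrite !sqrrN.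
  have [k k0 [E1 E2]] := sq a b ab; have [l l0 [E3 E4]] := sq _ _ ab'.
  have [T1 T2] := twist a b ab; rewrite T1 T2 in E3 E4.
  have Fab : 0 < F1 a b ^+ 2 + F2 a b ^+ 2 by apply: pos; rewrite ab.
  pose Z := (f1 * a + f2 * b) * X a b - (f2 * a - f1 * b) * Y a b.
  (* [Z + i H] is [F 0] times [conj u], [G u] and [G (- u)]. By the twist its square is a negative
     real number, so its imaginary part [H] is not zero. *)
  have : Z ^+ 2 - H a b ^+ 2 < 0.
    have -> : Z ^+ 2 - H a b ^+ 2 = - (k * l * (F1 a b ^+ 2 + F2 a b ^+ 2) *
        (f1 ^+ 2 + f2 ^+ 2) ^+ 2 * (a ^+ 2 + b ^+ 2) ^+ 2).
      move: E1 E2 E3 E4; rewrite -/f1 -/f2 /Z /H /X /Y.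
      set x1 := G1 a b; set x2 := G2 a b; set y1 := G1 _ _; set y2 := G2 _ _.
      set P := F1 a b; set Q := F2 a b => E1 E2 E3 E4.
      pose c := (f1 * a + f2 * b); pose d := (f2 * a - f1 * b).
      transitivity ((c ^+ 2 - d ^+ 2) *
         ((x1 ^+ 2 - x2 ^+ 2) * (y1 ^+ 2 - y2 ^+ 2) - (2 * x1 * x2) * (2 * y1 * y2)) -
         2 * c * d *
         ((x1 ^+ 2 - x2 ^+ 2) * (2 * y1 * y2) + (2 * x1 * x2) * (y1 ^+ 2 - y2 ^+ 2))).
        by rewrite /c /d; ring.
      by rewrite E1 E2 E3 E4 /c /d; ring.
    by rewrite oppr_lt0 ab !mulr_gt0 // exprn_gt0 // exprn_gt0.
  by rewrite Hab expr0n subr0 ltNge sqr_ge0.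
have cH : continuous (fun p => H (cos p) (sin p)).
  move=> p; have FF : ProperFilter (nbhs p) := nbhs_pfilter p.
  have cc : cos @ nbhs p --> cos p by exact: continuous_cos.
  have cs : sin @ nbhs p --> sin p by exact: continuous_sin.
  have cc' : (fun p => - cos p) @ nbhs p --> - cos p by exact: cvgN.
  have cs' : (fun p => - sin p) @ nbhs p --> - sin p by exact: cvgN.
  have cst (l : R) : (fun=> l) @ nbhs p --> l by exact: cvg_cst.
  have g1p := g1 _ _ _ _ _ _ FF cc cs; have g2p := g2 _ _ _ _ _ _ FF cc cs.
  have g1n := g1 _ _ _ _ _ _ FF cc' cs'; have g2n := g2 _ _ _ _ _ _ FF cc' cs'.
  apply: cvgD; apply: cvgM.
  - by apply: cvgD; exact: cvgM.
  - by apply: cvgD; exact: cvgM.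
  - by apply: cvgB; exact: cvgM.
  - by apply: cvgB; exact: cvgM.
have cw : {within `[0, pi], continuous (fun p => H (cos p) (sin p))}.
  exact: continuous_subspaceT.
have Hpi : H (cos pi) (sin pi) = - H (cos 0) (sin 0).
  by rewrite cospi sinpi cos0 sin0 -Hodd oppr0.
(* Along the half circle from angle 0 to [pi] the odd function [H] changes sign. *)
have [|p _] := @IVT R _ 0 pi 0 (pi_ge0 R) cw.
  rewrite Hpi; set z := H _ _; rewrite ge_min le_max oppr_le0 oppr_ge0.
  by case/orP: (le_total z 0) => ->; rewrite ?orbT.
by apply/eqP/H0; exact: cos2Dsin2.
Qed.

End JointContinuity.

(** * The upper hemisphere and its tangent planes *)

Section EvenTangentField.
Variable R : realType.
Implicit Types (v x y : 'rV[R]_3) (a b : R).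

Definition vec3 (a b c : R) : 'rV[R]_3 := \row_j [:: a; b; c]`_j.

Let i0 : 'I_3 := @Ordinal 3 0 isT.
Let i1 : 'I_3 := @Ordinal 3 1 isT.
Let i2 : 'I_3 := @Ordinal 3 2 isT.

Lemma dotv3E x y : dotv x y =
  x ord0 i0 * y ord0 i0 + x ord0 i1 * y ord0 i1 + x ord0 i2 * y ord0 i2.
Proof.
rewrite /dotv !big_ord_recl big_ord0 addr0 addrA.
by congr (x ord0 _ * y ord0 _ + x ord0 _ * y ord0 _ + x ord0 _ * y ord0 _);
  apply: val_inj.
Qed.

Lemma vec3E a b c : [/\ vec3 a b c ord0 i0 = a, vec3 a b c ord0 i1 = b &
  vec3 a b c ord0 i2 = c].
Proof. by split; rewrite mxE. Qed.

(** Outside the unit disc the square root takes the value 0, which makes [height] continuous on the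
    whole plane. *)
Let height a b := Num.sqrt (1 - a ^+ 2 - b ^+ 2).
Let hemisphere a b := vec3 a b (height a b).

Lemma hemisphere_unit a b : a ^+ 2 + b ^+ 2 <= 1 ->
  dotv (hemisphere a b) (hemisphere a b) = 1.
Proof.
move=> ab; rewrite dotv3E; have [-> -> ->] := vec3E a b (height a b).
by rewrite -!expr2 /height sqr_sqrtr; [ring|lra].
Qed.

Lemma hemisphere_neq0 a b : hemisphere a b != 0.
Proof.
have [ab|ab] := lerP (a ^+ 2 + b ^+ 2) 1.
  by rewrite -dotvv_eq0 hemisphere_unit // oner_eq0.
apply: contraTneq ab => h; have [Ea Eb _] := vec3E a b (height a b).
move: Ea Eb; rewrite -/(hemisphere a b) h !mxE => <- <-.
by rewrite expr0n addr0 -leNgt ler01.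
Qed.

Lemma cvg_height (T : Type) (F : set_system T) (a_ b_ : T -> R) a b :
  ProperFilter F -> a_ @ F --> a -> b_ @ F --> b ->
  (fun i => height (a_ i) (b_ i)) @ F --> height a b.
Proof.
move=> FF ca cb.
apply: (continuous_cvg _ (f := fun i => 1 - a_ i ^+ 2 - b_ i ^+ 2)).
  exact: sqrt_continuous.
apply: cvgB; last exact: cvgM.
by apply: cvgB; [exact: cvg_cst|exact: cvgM].
Qed.

Lemma cvg_hemisphere (T : Type) (F : set_system T) (a_ b_ : T -> R) a b :
  ProperFilter F -> a_ @ F --> a -> b_ @ F --> b ->
  (fun i => hemisphere (a_ i) (b_ i)) @ F --> hemisphere a b.
Proof.
move=> FF ca cb.
have ch := cvg_height FF ca cb.
apply: cvg_rV => -[[|[|[|//]]] lt_j3].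
- by rewrite (_ : Ordinal _ = i0); [rewrite mxE; under eq_fun do rewrite mxE|exact: val_inj].
- by rewrite (_ : Ordinal _ = i1); [rewrite mxE; under eq_fun do rewrite mxE|exact: val_inj].
- by rewrite (_ : Ordinal _ = i2); [rewrite mxE; under eq_fun do rewrite mxE|exact: val_inj].
Qed.

(* The rotation carrying [u] to the north pole identifies the tangent plane at [u]
   in the upper hemisphere with the horizontal plane. *)
Lemma even_tangent_field_vanishes (t : 'rV[R]_3 -> 'rV[R]_3) :
  (forall v, v != 0 -> {for v, continuous (fun x => t (normalize x))}) ->
  (forall v, dotv v v = 1 -> dotv v (t v) = 0) ->
  (forall v, dotv v v = 1 -> t (- v) = t v) ->
  exists2 v, dotv v v = 1 & t v = 0.
Proof.
move=> ct tv te.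
pose T a b := t (normalize (hemisphere a b)).
have cT j : jointly_continuous (fun a b => T a b ord0 j).
  move=> V F a_ b_ a b FF ca cb; apply: cvg_coord.
  have ch := cvg_hemisphere FF ca cb.
  exact: (continuous_cvg _ (ct _ (hemisphere_neq0 a b)) ch).
pose k a b := (1 + height a b)^-1.
have kh a b : k a b * (1 + height a b) = 1.
  by rewrite mulVf // gt_eqF // ltr_pwDl // sqrtr_ge0.
have ck : jointly_continuous k.
  move=> V F a_ b_ a b FF ca cb.
  apply: cvgV; first by rewrite gt_eqF // ltr_pwDl // sqrtr_ge0.
  apply: cvgD; first exact: cvg_cst.
  exact: cvg_height.
(* The horizontal coordinates of the rotated field: the rotation subtracts [T_3 / (1 + h)] times the
   sum of [u] and the north pole. *)
pose F1 a b := T a b ord0 i0 - T a b ord0 i2 * a * k a b.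
pose F2 a b := T a b ord0 i1 - T a b ord0 i2 * b * k a b.
have cF1 : jointly_continuous F1.
  move=> V F a_ b_ a b FF ca cb; apply: cvgB; first exact: cT.
  by apply: cvgM; [apply: cvgM => //; exact: cT|exact: ck].
have cF2 : jointly_continuous F2.
  move=> V F a_ b_ a b FF ca cb; apply: cvgB; first exact: cT.
  by apply: cvgM; [apply: cvgM => //; exact: cT|exact: ck].
have normalize1 v : dotv v v = 1 -> normalize v = v.
  by move=> vv; rewrite /normalize vv sqrtr1 invr1 scale1r.
have orth a b : a ^+ 2 + b ^+ 2 <= 1 ->
    a * T a b ord0 i0 + b * T a b ord0 i1 + height a b * T a b ord0 i2 = 0.
  move=> ab; have u1 := hemisphere_unit ab; have := tv _ u1.
  rewrite -{2}(normalize1 _ u1) -/(T a b) dotv3E.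
  by have [-> -> ->] := vec3E a b (height a b).
have [a [b [ab1 [f1 f2]]]] : exists a b, a ^+ 2 + b ^+ 2 <= 1 /\ F1 a b = 0 /\ F2 a b = 0.
  apply: twisted_field_vanishes => // a b ab.
  have ab1 : a ^+ 2 + b ^+ 2 <= 1 by rewrite ab.
  have ht : height a b = 0 by rewrite /height (_ : _ - _ = 0) ?sqrtr0 //; lra.
  have ht' : height (- a) (- b) = 0 by rewrite /height !sqrrN.
  have TT : T (- a) (- b) = T a b.
    have hN : hemisphere (- a) (- b) = - hemisphere a b.
      rewrite /hemisphere ht ht'; apply/rowP => -[[|[|[|//]]] lt_j3];
        by rewrite !mxE //= oppr0.
    have u1 := hemisphere_unit ab1.
    rewrite /T hN !normalize1 //; first exact: te.
    by rewrite !dotE opprK.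
  have := orth _ _ ab1; rewrite /F1 /F2 TT /k ht ht' addr0 invr1 mul0r addr0.
  set x := T a b ord0 i0; set y := T a b ord0 i1; set z := T a b ord0 i2 => xy.
  have e1 : (a * x + b * y) * a = 0 by rewrite xy mul0r.
  have e2 : (a * x + b * y) * b = 0 by rewrite xy mul0r.
  have e3 : (a ^+ 2 + b ^+ 2) * x = x by rewrite ab mul1r.
  have e4 : (a ^+ 2 + b ^+ 2) * y = y by rewrite ab mul1r.
  have e5 : (a ^+ 2 + b ^+ 2) * (z * a) = z * a by rewrite ab mul1r.
  have e6 : (a ^+ 2 + b ^+ 2) * (z * b) = z * b by rewrite ab mul1r.
  by split; lra.
have u1 := hemisphere_unit ab1.
exists (hemisphere a b) => //; rewrite -[X in t X](normalize1 _ u1) -/(T a b).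
have := orth _ _ ab1; have := kh a b; move: f1 f2; rewrite /F1 /F2.
have hh : height a b ^+ 2 = 1 - a ^+ 2 - b ^+ 2 by rewrite sqr_sqrtr //; lra.
have : dotv (T a b) (T a b) == 0 -> T a b = 0 by rewrite dotvv_eq0 => /eqP.
rewrite dotv3E; set x := T a b ord0 i0; set y := T a b ord0 i1.
set z := T a b ord0 i2; set l := k a b; set h := height a b in hh * => T0 X Y lh o.
(* A zero of [F] makes the horizontal part of [T] equal to [z l (a, b)]; orthogonality to [u] then
   reads [z (l (1 - h^2) + h) = 0], where the bracket is 1. *)
have z0 : z = 0.
  have xE : x = z * a * l by lra.
  have yE : y = z * b * l by lra.
  have : z * (l * (1 - h ^+ 2) + h) = 0.
    by rewrite hh -[RHS]o xE yE; ring.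
  have -> : l * (1 - h ^+ 2) = 1 - h.
    by rewrite (_ : 1 - h ^+ 2 = (1 + h) * (1 - h)); [rewrite mulrA lh mul1r|ring].
  by rewrite subrK mulr1.
by apply: T0; move: X Y; rewrite z0 !mul0r !subr0 => -> ->; rewrite !mul0r !addr0.
Qed.

End EvenTangentField.

(** * Reduction to dimension three *)

Section ConvexBodies.
Variables (R : realType) (n : nat).
Implicit Types (x y z u v p : 'rV[R]_n) (K : set 'rV[R]_n).

Lemma convex_set_segment K : convex_set K -> segment_closed K.
Proof.
move=> cK x y l Kx Ky /andP[l0 l1].
have := cK y x (Itv01 l0 l1); rewrite !inE => /(_ Ky Kx).
by congr K; rewrite addrC.
Qed.

(** The direction from the nearest point [y0] of [K] to [z] separates: it makes no acute angle with
    any [y - y0], since otherwise a small move towards [y] would come closer to [z]. *)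
Lemma separation K z : compact K -> segment_closed K -> K !=set0 -> ~ K z ->
  exists2 u, dotv u u = 1 & forall y, K y -> dotv u y < dotv u z.
Proof.
move=> cK sK K0 Kz.
have [|y0] := @EVT_min_rV R n (fun y => dotv (y - z) (y - z)) K K0 cK.
  by apply: continuous_subspaceT; exact: sqdist_continuous.
rewrite inE => Ky0 ymin.
have [d dE] : exists d, d = z - y0 by exists (z - y0).
have d0 : d != 0.
  by rewrite dE subr_eq0; apply: contra_notN Kz => /eqP ->.
have dd := dotvv_gt0 d0.
have obtuse y : K y -> dotv d (y - y0) <= 0.
  move=> Ky; have [e eE] : exists e, e = y - y0 by exists (y - y0).
  rewrite -eE leNgt; apply/negP => de.
  have ee := dotvv_ge0 e.
  pose l := dotv d e / (dotv d e + dotv e e).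
  have den : 0 < dotv d e + dotv e e by rewrite ltr_pwDl.
  have l0 : 0 < l by rewrite divr_gt0.
  have l1 : l <= 1 by rewrite ler_pdivrMr // mul1r lerDl.
  have lE : l * (dotv d e + dotv e e) = dotv d e by rewrite divfK // gt_eqF.
  have Kl := sK _ _ l Ky0 Ky.
  have := ymin ((1 - l) *: y0 + l *: y); rewrite inE => /(_ (Kl _)).
  rewrite (ltW l0) l1 => /(_ isT).
  have -> : y0 - z = - d by rewrite dE opprB.
  have -> : (1 - l) *: y0 + l *: y - z = l *: e - d.
    by rewrite eE dE; apply/rowP => j; rewrite !mxE; ring.
  rewrite !dotE (dotvC e d) => H.
  have : 0 <= l * (l * dotv e e - 2 * dotv d e) by lra.
  by rewrite pmulr_rge0 //; nra.
exists (normalize d); first exact: normalize_dotvv.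
move=> y Ky; rewrite /normalize !dotvZl ltr_pM2l ?invr_gt0 ?sqrtr_gt0 //.
have := obtuse _ Ky; rewrite dotvDr dotvNr => h.
have : dotv d d = dotv d z - dotv d y0 by rewrite {2}dE dotvDr dotvNr.
by lra.
Qed.

Lemma compact_ball_dotv (C : R) : compact [set x : 'rV[R]_n | dotv x x <= C].
Proof.
apply: bounded_closed_compact.
  exists (Num.sqrt C); split; first exact: num_real.
  move=> M CM x /= xC; rewrite [`|_|]mx_normE.
  apply: (@big_ind _ (fun z : {nonneg R} => z%:num <= M)) => //=.
  - by apply: le_trans (ltW CM); exact: sqrtr_ge0.
  - by move=> a b aM bM; rewrite num_max ge_max aM bM.
  move=> [i j] _ /=; rewrite (ord1 i) -sqrtr_sqr; apply: le_trans (ltW CM).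
  by apply: ler_wsqrtr; exact: le_trans (coord_sqr_le_dotvv x j) xC.
apply: (continuous_closedP (fun x : 'rV[R]_n => dotv x x)).1 (closed_le (y := C)).
move=> x; have FF : ProperFilter (nbhs (x : 'rV[R]_n)) := nbhs_pfilter _.
exact: (@cvg_dotv R n _ (nbhs x) (nbhs_pfilter x) id id x x cvg_id cvg_id).
Qed.

Lemma enorm_dotvE x (r : R) : 0 <= r -> enorm x = r <-> dotv x x = r ^+ 2.
Proof.
move=> r0; rewrite /enorm; split=> [<-|->].
  by rewrite sqr_sqrtr // dotvv_ge0.
by rewrite sqrtr_sqr ger0_norm.
Qed.

Lemma exists_unit : (0 < n)%N -> exists e : 'rV[R]_n, dotv e e = 1.
Proof. by move=> n0; have [e ee _] := exists_unit_orthogonal (0 : 'M[R]_(0, n)) n0; exists e. Qed.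

Lemma ball_of_sphere K p (r : R) : (0 < n)%N -> segment_closed K -> 0 < r ->
  esphere p r `<=` K -> forall x, dotv (x - p) (x - p) <= r ^+ 2 -> K x.
Proof.
move=> n0 sK r0 SK x xr.
have [e [s [ee s0 xE]]] : exists e s, [/\ dotv e e = 1, 0 <= s & x = p + s *: e].
  have [/eqP xp|xp] := eqVneq (x - p) 0.
    have [e ee] := exists_unit n0; exists e, 0; split=> //.
    by move: xp; rewrite subr_eq0 scale0r addr0 => /eqP.
  exists (normalize (x - p)), (Num.sqrt (dotv (x - p) (x - p))); split.
  - exact: normalize_dotvv.
  - exact: sqrtr_ge0.
  - rewrite /normalize scalerA divff ?scale1r; first by rewrite addrC subrK.
    by rewrite gt_eqF // sqrtr_gt0 dotvv_gt0.
have sr : s <= r.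
  move: xr; rewrite xE (addrC p) addrK !dotE ee mulr1 -expr2.
  by rewrite ler_sqr ?nnegrE // ltW.
have Sk (k : R) : k ^+ 2 = r ^+ 2 -> K (p + k *: e).
  move=> kr; apply: SK; apply/enorm_dotvE; first exact: ltW.
  by rewrite (addrC p) addrK !dotE ee mulr1 -expr2.
have := sK _ _ ((r + s) / (2 * r)) (Sk (- r) (sqrrN r)) (Sk r erefl).
have -> : 0 <= (r + s) / (2 * r) <= 1.
  rewrite divr_ge0 ?addr_ge0 ?mulr_ge0 ?(ltW r0) //=.
  by rewrite ler_pdivrMr ?mulr_gt0 //; lra.
move/(_ isT); congr K; rewrite xE; apply/rowP => j; rewrite !mxE; field.
by rewrite gt_eqF.
Qed.

(** Otherwise points outside the body at distances tending to the radius would accumulate at a point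
    of the sphere, which is interior to [K]. *)
Lemma larger_ball K p (r : R) : (0 < n)%N -> segment_closed K -> 0 < r ->
  esphere p r `<=` K° ->
  exists2 q : R, 0 < q & forall x, dotv x x <= (1 + q) ^+ 2 -> K (p + r *: x).
Proof.
move=> n0 sK r0 SK.
have Kball x : dotv x x <= 1 -> K (p + r *: x).
  move=> x1; apply: (@ball_of_sphere K p r) => //.
    by move=> y /SK; exact: interior_subset.
  rewrite (addrC p) addrK !dotE mulrA -expr2 -[leRHS]mulr1 ler_pM2l //.
  by rewrite exprn_gt0.
apply: contrapT => nq.
have /choice[x_ hx] : forall N : nat, exists x,
    dotv x x <= (1 + N.+1%:R^-1) ^+ 2 /\ ~ K (p + r *: x).
  move=> N; apply: contrapT => nx; apply: nq; exists N.+1%:R^-1.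
    by rewrite invr_gt0.
  by move=> x xN; apply: contrapT => Kx; apply: nx; exists x.
have [U [UU Uoo]] := ultraFilterLemma eventually_filter.
have PU : ProperFilter U by exact: ultra_proper.
have [|x _ cx] := ultra_compact_cvg (f := x_) UU (@compact_ball_dotv 4).
  apply: filterE => N /=; have [xN _] := hx N; apply: (le_trans xN).
  have : N.+1%:R^-1 <= 1 :> R by rewrite invf_le1 // ler1n.
  have : 0 <= N.+1%:R^-1 :> R by [].
  by move: (N.+1%:R^-1 : R) => h h0 h1; nra.
have cxx := cvg_dotv (FF := PU) cx cx.
have x1 : dotv x x = 1.
  apply/eqP; rewrite eq_le; apply/andP; split.
    have cN : (fun N : nat => (1 + N.+1%:R^-1) ^+ 2 : R) @ U --> ((1 + 0) ^+ 2 : R).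
      have ch : (fun N : nat => 1 + N.+1%:R^-1 : R) @ U --> (1 + 0 : R).
        apply: cvgD; first exact: cvg_cst.
        have hc : @harmonic R @ \oo --> (0 : R) by exact: cvg_harmonic.
        by apply: cvg_trans hc; exact: cvg_app.
      exact: cvgM.
    have := ler_cvg_filter (FF := PU) cxx cN; rewrite addr0 expr1n; apply.
    by apply: filterE => N; have [] := hx N.
  apply: (cvgr_to_ge cxx); apply: filterE => N; rewrite leNgt; apply/negP => /ltW.
  by move/Kball; have [_] := hx N.
have Sx : esphere p r (p + r *: x).
  apply/enorm_dotvE; first exact: ltW.
  by rewrite (addrC p) addrK !dotE x1 mulr1 expr2.
have cpx : (fun N => p + r *: x_ N) @ U --> p + r *: x.
  by apply: cvgD; [exact: cvg_cst|apply: cvgZ => //; exact: cvg_cst].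
have UK : U [set N | K (p + r *: x_ N)] by apply: cpx; exact: (SK _ Sx).
by have [N KN] := filter_ex UK; have [_] := hx N.
Qed.

End ConvexBodies.

(** * Central symmetry in dimension three *)

Section SpaceCase.
Variable R : realType.
Variables (K : set 'rV[R]_3) (q : R) (t c : 'rV[R]_3 -> 'rV[R]_3).

Lemma symmetric_of_tangent_pair : tangent_pair K [set x | K (- x)] q t c ->
  forall x, K x -> K (- x).
Proof.
move=> tp.
(* Negating the relation between the sections of [K] and [-K] at [v] exchanges the two bodies and
   reverses the translation, giving the same shift at [- v]. *)
have even v : dotv v v = 1 -> t (- v) = t v.
  move=> vv; have vv' : dotv (- v) (- v) = 1 by rewrite !dotE opprK.
  apply/esym/(shift_unique tp) => //; first by rewrite dotvNl (tp_perp tp) // oppr0.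
  move=> x Kx; rewrite dotvNl => vx /=; rewrite opprD.
  have vx' : dotv v (- x) = 1 by rewrite dotvNr.
  by apply/(tp_shift tp vv vx'); rewrite /= opprK.
have [u uu tu] := even_tangent_field_vanishes (shift_continuous tp) (tp_perp tp) even.
have sym v x : dotv v v = 1 -> dotv v x = 1 -> K x -> K (- x).
  move=> vv vx Kx; apply/(tp_shift tp vv vx).
  by rewrite (shift_vanishes (isT : (2 < 3)%N) tp uu vv tu) subr0.
move=> x Kx; have [xx|xx] := lerP (dotv x x) 1.
  apply: (tp_ball tp); rewrite !dotE opprK; have := tp_q tp; nra.
have [e [ee xe _]] := exists_unit_orthogonal2 x x (isT : (2 < 3)%N).
have x0 : dotv x x != 0 by rewrite gt_eqF // (lt_trans ltr01).
(* With this [s], the vector [x / |x|^2 + s e] has length 1 and its tangent plane passes through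
   [x]. *)
pose s := Num.sqrt (1 - (dotv x x)^-1).
have ss : s ^+ 2 = 1 - (dotv x x)^-1.
  by rewrite sqr_sqrtr // subr_ge0 invf_le1 // ?ltW // (lt_trans ltr01).
apply: (sym ((dotv x x)^-1 *: x + s *: e)) => //; rewrite !dotE (dotvC e x) xe.
  by rewrite ee !mulr0 addr0 add0r mulr1 mulVf // mulr1 -expr2 ss addrC subrK.
by rewrite mulr0 addr0 mulVf.
Qed.

End SpaceCase.

(** * Projection to three-dimensional subspaces *)

Section Projection.
Variables (R : realType) (n : nat).
Variables (M : 'M[R]_(n, 3)) (K : set 'rV[R]_n) (p : 'rV[R]_n) (r : R).
Hypothesis MM : M^T *m M = 1%:M.
Hypothesis r0 : 0 < r.
Hypothesis cK : compact K.
Hypothesis sK : segment_closed K.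

(** The columns of [M] are an orthonormal frame; the translation and the scaling turn the sphere
    about [p] of radius [r] into the unit sphere about 0. *)
Definition frame_proj (x : 'rV[R]_n) : 'rV[R]_3 := r^-1 *: ((x - p) *m M).

Lemma dotv_mulmx (x : 'rV[R]_n) (v : 'rV[R]_3) : dotv v (x *m M) = dotv (v *m M^T) x.
Proof.
have : (dotv v (x *m M))%:M = (dotv (v *m M^T) x)%:M :> 'M[R]_1.
  by rewrite -!mulmx_tr_dotv trmx_mul mulmxA.
by move/matrixP/(_ ord0 ord0); rewrite !mxE !eqxx !mulr1n.
Qed.

Lemma frame_dotvv (v : 'rV[R]_3) : dotv (v *m M^T) (v *m M^T) = dotv v v.
Proof. by rewrite -dotv_mulmx -mulmxA MM mulmx1. Qed.

Lemma dotv_frame_proj v x :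
  dotv v (frame_proj x) = r^-1 * (dotv (v *m M^T) x - dotv (v *m M^T) p).
Proof. by rewrite /frame_proj dotvZr dotv_mulmx dotvDr dotvNr. Qed.

Lemma frame_proj_section v x :
  dotv v (frame_proj x) = 1 <-> dotv (v *m M^T) x = dotv (v *m M^T) p + r.
Proof.
rewrite dotv_frame_proj; split=> [h|->]; last first.
  by rewrite addrAC subrr add0r mulVf // gt_eqF.
by move/(congr1 ( *%R r)): h; rewrite mulVKf ?gt_eqF // mulr1; lra.
Qed.

Lemma frame_proj_continuous : continuous frame_proj.
Proof.
move=> x; have FF : ProperFilter (nbhs (x : 'rV[R]_n)) := nbhs_pfilter _.
apply: (cvg_rV (F := nbhs (x : 'rV[R]_n))) => i.
pose Mi : 'rV[R]_n := \row_j M j i.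
have E y : frame_proj y ord0 i = r^-1 * dotv (y - p) Mi.
  by rewrite !mxE; congr (_ * _); apply: eq_bigr => j _; rewrite !mxE.
rewrite E; under eq_fun do rewrite E; apply: cvgM; first exact: cvg_cst.
apply: cvg_dotv; last exact: cvg_cst.
by apply: cvgB; [exact: cvg_id|exact: cvg_cst].
Qed.

Let K1 := frame_proj @` K.

Lemma tangent_supporting_hyperplane (u : 'rV[R]_n) : dotv u u = 1 ->
  supporting_hyperplane (esphere p r) (hyperplane u (dotv u p + r)).
Proof.
move=> uu; exists u, (dotv u p + r); split=> //.
- by rewrite -dotvv_eq0 uu oner_eq0.
- exists (p + r *: u); split; first by rewrite /hyperplane /= !dotE uu mulr1.
  apply/enorm_dotvE; first exact: ltW.
  by rewrite (addrC p) addrK !dotE uu mulr1 expr2.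
move=> x /(enorm_dotvE _ (ltW r0)) xr /=.
have := dotv_cauchy u (x - p); rewrite uu xr mul1r.
rewrite dotvDr dotvNr; set d := _ - _ => dr.
suff : d <= r by rewrite /d; lra.
rewrite leNgt; apply/negP => rd.
have h1 : 0 < d - r by lra.
have h2 : 0 < d + r by have := r0; lra.
by have := mulr_gt0 h1 h2; rewrite -subr_sqr; lra.
Qed.

Hypothesis hsym : forall H : set 'rV[R]_n,
  supporting_hyperplane (esphere p r) H -> centrally_symmetric (H `&` K).
Hypothesis htrans : forall H1 H2 : set 'rV[R]_n,
  supporting_hyperplane (esphere p r) H1 -> supporting_hyperplane (esphere p r) H2 ->
  parallel_hyperplanes H1 H2 -> translated (H1 `&` K) (H2 `&` K).
Variable q : R.
Hypothesis q0 : 0 < q.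
Hypothesis Kball : forall x, dotv x x <= (1 + q) ^+ 2 -> K (p + r *: x).

Lemma tangent_data (v : 'rV[R]_3) : exists tc : 'rV[R]_3 * 'rV[R]_3,
  dotv v v = 1 ->
  [/\ dotv v tc.1 = 0,
      forall x, dotv v x = 1 -> K1 (- x) <-> K1 (x - tc.1),
      dotv v tc.2 = 1 &
      forall x, dotv v x = 1 -> K1 x -> K1 (tc.2 *+ 2 - x)].
Proof.
have [vv|nv] := pselect (dotv v v = 1); last by exists (0, 0).
pose u := v *m M^T; have uu : dotv u u = 1 by rewrite frame_dotvv.
have uu' : dotv (- u) (- u) = 1 by rewrite !dotE opprK.
pose H1 := hyperplane u (dotv u p + r).
pose H2 := hyperplane (- u) (dotv (- u) p + r).
have S1 := tangent_supporting_hyperplane uu.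
have S2 := tangent_supporting_hyperplane uu'.
have H2E x : H2 x <-> dotv u x = dotv u p - r.
  by rewrite /H2 /hyperplane /= !dotvNl; split=> h; lra.
have [C HC] := hsym S1.
have [w Hw] : translated (H1 `&` K) (H2 `&` K).
  apply: htrans => //; exists u, (dotv u p + r), (dotv u p - r); split=> //.
    by rewrite -dotvv_eq0 uu oner_eq0.
  by apply/seteqP; split=> x /H2E.
have refl x : H1 x -> K x -> H1 (C *+ 2 - x) /\ K (C *+ 2 - x).
  by move=> h k; have : (H1 `&` K) (C *+ 2 - x) by rewrite -HC; exists x.
pose a := p + r *: u.
have Ha : H1 a by rewrite /H1 /hyperplane /= !dotE uu mulr1.
have Ka : K a by apply: Kball; rewrite uu; have := q0; nra.
have uC : dotv u C = dotv u p + r.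
  have [h _] := refl _ Ha Ka; move: h Ha.
  by rewrite /H1 /hyperplane /= dotvDr dotvNr mulr2n dotvDr => h1 h2; lra.
have trans x : H1 x -> K x -> H2 (w + x) /\ K (w + x).
  by move=> h k; have : (H2 `&` K) (w + x) by rewrite Hw; exists x.
have uw : dotv u w = - r *+ 2.
  have [/H2E h _] := trans _ Ha Ka; move: h Ha.
  by rewrite /H1 /hyperplane /= dotvDr mulr2n => h1 h2; lra.
(* The projections of [w + X] and of the reflection [C *+ 2 - X] add up to the constant [s]. Hence
   the section of the negated projection is that of the projection translated by [- s]. *)
pose s := r^-1 *: ((w + C *+ 2 - p *+ 2) *m M).
have vs : dotv v s = 0.
  rewrite /s !mulr2n dotvZr dotv_mulmx -/u !(dotvDr, dotvNr) uw uC mulr2n.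
  by ring.
have fiber x : dotv v x = 1 -> K1 x <-> exists X, [/\ H1 X, K X & frame_proj X = x].
  move=> vx; split=> [[X KX XE]|[X [_ KX XE]]]; last by exists X.
  exists X; split=> //; apply/frame_proj_section; by rewrite XE.
have key X : frame_proj (w + X) = s - frame_proj (C *+ 2 - X).
  rewrite /frame_proj /s -scalerBr -mulmxBl; congr (_ *: (_ *m _)).
  by apply/rowP => j; rewrite !mulr2n !mxE; ring.
exists (- s, frame_proj C) => _ /=; split.
- by rewrite dotvNr vs oppr0.
- move=> x vx; rewrite opprK; have vxs : dotv v (x + s) = 1 by rewrite dotvDr vx vs addr0.
  split.
    move=> [Y KY YE].
    have HY : H2 Y.
      apply/H2E; have := congr1 (dotv v) YE; rewrite dotv_frame_proj -/u dotvNr vx.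
      by move/(congr1 ( *%R r)); rewrite mulVKf ?gt_eqF // mulrN1; lra.
    have : (H2 `&` K) Y by split.
    rewrite Hw => -[X [HX KX] XY].
    exists (C *+ 2 - X); first by have [] := refl _ HX KX.
    have := key X; rewrite XY YE => E.
    by rewrite -[x]opprK E opprB subrK.
  move=> /(fiber _ vxs)[X [HX KX XE]].
  have [HX' KX'] := refl _ HX KX; have [_ KY] := trans _ HX' KX'.
  exists (w + (C *+ 2 - X)) => //; rewrite key.
  have -> : C *+ 2 - (C *+ 2 - X) = X by rewrite opprB addrCA subrr addr0.
  by rewrite XE opprD addrCA subrr addr0.
- by apply/frame_proj_section.
move=> x vx /(fiber _ vx)[X [HX KX <-]].
have [HX' KX'] := refl _ HX KX; exists (C *+ 2 - X) => //.
rewrite /frame_proj [in RHS]mulr2n -scalerDr -scalerBr -mulmxDl -mulmxBl.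
congr (_ *: (_ *m _)).
by apply/rowP => j; rewrite !mulr2n !mxE; ring.
Qed.

Lemma projection_symmetric x : K1 x -> K1 (- x).
Proof.
have cK1 : compact K1.
  by apply: continuous_compact cK; apply: continuous_subspaceT; exact: frame_proj_continuous.
have sK1 : segment_closed K1.
  move=> _ _ l [y Ky <-] [z Kz <-] l01; exists ((1 - l) *: y + l *: z); first exact: sK.
  rewrite /frame_proj !scalerA !(mulrC _ r^-1) -!scalerA -scalerDr !scalemxAl -mulmxDl -scalemxAl.
  by congr (_ *: (_ *m _)); apply/rowP => j; rewrite !mxE; ring.
have bK1 y : dotv y y <= (1 + q) ^+ 2 -> K1 y.
  move=> yq; exists (p + r *: (y *m M^T)); first by apply: Kball; rewrite frame_dotvv.
  rewrite /frame_proj (addrC p) addrK -scalemxAl scalerA mulVf ?gt_eqF // scale1r.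
  by rewrite -mulmxA MM mulmx1.
have /choice[tc htc] := tangent_data.
apply: (symmetric_of_tangent_pair (q := q) (t := fun v => (tc v).1)
  (c := fun v => (tc v).2)); split=> //.
- move=> y z l /= Ky Kz l01; have := sK1 _ _ _ Ky Kz l01.
  by congr K1; rewrite opprD !scalerN.
- have -> : [set x | K1 (- x)] = -%R @` K1.
    apply/seteqP; split=> y /=; first by move=> Ky; exists (- y); rewrite ?opprK.
    by move=> [z Kz <-]; rewrite opprK.
  apply: continuous_compact cK1; apply: continuous_subspaceT => y.
  exact: opp_continuous.
- by move=> y yq; apply: bK1; rewrite !dotE opprK.
- by move=> v /htc[].
- by move=> v y /htc[_ + _ _]; exact.
- by move=> v /htc[].
- by move=> v y /htc[_ _ _ +]; exact.
Qed.

End Projection.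

(** * From symmetric projections to a symmetric body *)

Lemma orthonormal_frame (R : realType) (n : nat) (u : 'rV[R]_n) : (3 <= n)%N ->
  dotv u u = 1 -> exists2 M : 'M[R]_(n, 3), M^T *m M = 1%:M
    & exists v : 'rV[R]_3, v *m M^T = u.
Proof.
move=> n3 uu.
have [e [ee ue _]] := exists_unit_orthogonal2 u u n3.
have [f [ff uf ef]] := exists_unit_orthogonal2 u e n3.
pose b (j : 'I_3) : 'rV[R]_n := [:: u; e; f]`_j.
exists (\matrix_(i, j) b j ord0 i).
  apply/matrixP => j k; rewrite !mxE.
  transitivity (dotv (b j) (b k)).
    by apply: eq_bigr => i _; rewrite !mxE.
  by case: j k => [[|[|[|//]]] ?] [[|[|[|//]]] ?]; rewrite /b /= ?uu ?ee ?ff;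
    rewrite ?ue ?uf ?ef // dotvC ?ue ?uf ?ef.
exists (delta_mx ord0 ord0); rewrite -rowE; apply/rowP => i.
by rewrite !mxE.
Qed.

Theorem corollary1 (R : realType) (n : nat) (hn : (3 <= n)%N)
  (K : set 'rV[R]_n) (hK : convex_body K)
  (S : set 'rV[R]_n) (p : 'rV[R]_n) (hS : is_sphere S p)
  (hSK : S `<=` K°)
  (hsym : forall H : set 'rV[R]_n,
     supporting_hyperplane S H -> centrally_symmetric (H `&` K))
  (htrans : forall H1 H2 : set 'rV[R]_n,
     supporting_hyperplane S H1 -> supporting_hyperplane S H2 ->
     parallel_hyperplanes H1 H2 -> translated (H1 `&` K) (H2 `&` K)) :
  centrally_symmetric K.
Proof.
have [cK xK [z0 /interior_subset Kz0]] := hK; have [r r0 SE] := hS; subst S.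
have sK := convex_set_segment xK.
have n0 : (0 < n)%N by apply: leq_trans hn.
have [q q0 Kq] := larger_ball n0 sK r0 hSK.
have sym x : K x -> K (p *+ 2 - x).
  move=> Kx; apply: contrapT => nK.
  (* If the reflection of [x] were outside [K], a direction [u] would separate it strictly. Symmetry
     of a projection whose frame contains [u] yields [y] in [K] with the same product with [u] as
     that reflection, a contradiction. *)
  have [u uu sep] := separation cK sK (ex_intro _ z0 Kz0) nK.
  have [M MM [v vM]] := orthonormal_frame hn uu.
  have K1x : (frame_proj M p r @` K) (frame_proj M p r x) by exists x.
  have [y Ky yx] := projection_symmetric MM r0 cK sK hsym htrans q0 Kq K1x.
  have := congr1 (dotv v) yx; rewrite dotvNr !dotv_frame_proj vM.
  move/(congr1 ( *%R r)); rewrite mulrN !mulVKf ?gt_eqF // => E.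
  by have := sep _ Ky; rewrite dotvDr dotvNr mulr2n dotvDr; lra.
exists p; apply/seteqP; split=> [_ [x Kx <-]|x Kx]; first exact: sym.
by exists (p *+ 2 - x); [exact: sym|rewrite opprB addrCA subrr addr0].
Qed.
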